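(* Let $X$ be a geometric Brownian motion, $dX_t=\mu X_t\,dt+\sigma X_t\,dW_t$, with $\mu\in\mathbb R$, $\sigma>0$ constants and $W$ a standard Brownian motion, with state space $\mathbb X=(0,\infty)$; let $f(x)=x$ on $\mathbb X$ and $\delta(t)=\frac1{1+\beta t}$ with $\beta>0$. Let $\nu:=\frac{\mu}{\sigma^2}-\frac12$ and suppose $\nu>0$. Then $R^*:=\bigcap_{R\in\mathcal E,\ R\text{ closed}}R$ equals $\emptyset$, and it is an optimal equilibrium.
   Context: $\mathcal B(\mathbb X)$ is the collection of Borel subsets of $\mathbb X$; $\mathbb P^x,\mathbb E^x$ denote probability and expectation given $X_0=x$, and $X^x$ denotes $X$ started at $x\in\mathbb X$. For $x\in\mathbb X$, $R\in\mathcal B(\mathbb X)$: $\rho(x,R):=\inf\{t>0: X^x_t\in R\}$ ($\inf\emptyset=\infty$) and $J(x,R):=\mathbb E^x[\delta(\rho(x,R))f(X_{\rho(x,R)})]\in[0,\infty]$, where on $\{\rho(x,R)=\infty\}$ the integrand is taken to be $\limsup_{t\to\infty}\delta(t)f(X^x_t)$. Put $S_R:=\{x: f(x)>J(x,R)\}$, $I_R:=\{x: f(x)=J(x,R)\}$, and $\Theta(R):=S_R\cup(I_R\cap R)$. $R\in\mathcal B(\mathbb X)$ is an equilibrium if $\Theta(R)=R$; $\mathcal E$ is the set of all equilibria. $V(x,R):=\max\{f(x),J(x,R)\}$. $\hat R\in\mathcal E$ is an optimal equilibrium if $V(x,\hat R)\ge V(x,R)$ for all $x\in\mathbb X$ and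 all $R\in\mathcal E$. ''Closed'' means closed relative to $\mathbb X$. *)

(* Defs.v *)
From HB Require Import structures.
From mathcomp Require Import all_boot all_order all_algebra.
From mathcomp Require Import all_classical all_reals all_analysis.
Set Implicit Arguments.
Unset Strict Implicit.
Unset Printing Implicit Defensive.
Import Order.TTheory GRing.Theory Num.Theory.
Import numFieldNormedType.Exports.
Local Open Scope classical_set_scope.
Local Open Scope ring_scope.

(* Processes are maps R -> T -> R of which only the times t >= 0 matter. *)

Section processes.
Context d (T : measurableType d) (R : realType) (P : probability T R).
Implicit Types (F : R -> set (set T)) (W X H : R -> T -> R) (Y : T -> R).

Definition filtration F : Prop :=
  [/\ forall t, 0 <= t -> sigma_algebra setT (F t),
      forall t, 0 <= t -> F t `<=` measurable &
      forall s t, 0 <= s -> s <= t -> F s `<=` F t].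

Definition measurable_wrt (G : set (set T)) Y : Prop :=
  forall B : set R, measurable B -> G (Y @^-1` B).

Definition adapted F X : Prop := forall t, 0 <= t -> measurable_wrt (F t) (X t).

Definition continuous_paths X : Prop :=
  forall w, {within `[0, +oo[, continuous (fun t => X t w)}.

(* The second parameter of normal_prob is the standard deviation. *)
Definition brownian_motion F W : Prop :=
  [/\ adapted F W, continuous_paths W, {ae P, forall w, W 0 w = 0},
      forall s t : R, 0 <= s -> s < t ->
        forall (A : set T) (B : set R), F s A -> measurable B ->
        P (A `&` (W t \- W s) @^-1` B) = (P A * P ((W t \- W s)%R @^-1` B))%E &
      forall s t : R, 0 <= s -> s < t -> forall B : set R, measurable B ->
        P ((W t \- W s) @^-1` B) = normal_prob 0 (Num.sqrt (t - s)) B].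

(* The process equal to sp_coef i on ]sp_time i, sp_time i.+1] for
   i < sp_size, and to 0 elsewhere. *)
Record simple_process F := SimpleProcess {
  sp_size : nat;
  sp_time : nat -> R;
  sp_coef : nat -> T -> R;
  sp_time_ge0 : forall i, 0 <= sp_time i;
  sp_time_nd : forall i, sp_time i <= sp_time i.+1;
  sp_coef_meas : forall i, measurable_wrt (F (sp_time i)) (sp_coef i) }.

Definition sp_val F (K : simple_process F) (s : R) (w : T) : R :=
  \sum_(i < sp_size K)
    sp_coef K i w * \1_(`]sp_time K i, sp_time K i.+1]%classic) s.

Definition sp_integral F W (K : simple_process F) (t : R) (w : T) : R :=
  \sum_(i < sp_size K) sp_coef K i w *
    (W (Num.min (sp_time K i.+1) t) w - W (Num.min (sp_time K i) t) w).

Definition cvg_in_probability (Y_ : nat -> T -> R) Y : Prop :=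
  forall e : R, 0 < e -> P [set w | e <= `|Y_ n w - Y w|] @[n --> \oo] --> 0%E.

(* \int_0^t (H_s - K^n_s)^2 ds tends to 0 in probability. *)
Definition approximates F H (t : R) (K : nat -> simple_process F) : Prop :=
  forall e : R, 0 < e ->
    P [set w | (e%:E <= \int[lebesgue_measure]_(s in `[0%R, t])
                          ((H s w - sp_val (K n) s w) ^+ 2)%:E)%E]
      @[n --> \oo] --> 0%E.

(* Y is (a version of) the Ito integral \int_0^t H dW: the limit in probability
   of the integrals of simple processes approximating H, which does not depend
   on the approximating sequence. *)
Definition is_ito_integral F W H (t : R) Y : Prop :=
  [/\ measurable_fun setT Y,
      exists K : nat -> simple_process F, approximates H t K &
      forall K : nat -> simple_process F, approximates H t K ->
        cvg_in_probability (fun n => sp_integral W (K n) t) Y].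

Definition state_space : set R := `]0, +oo[%classic.

(* dX = mu X dt + sigma X dW with X_0 = x, X taking values in the state space. *)
Definition geometric_brownian_motion (mu sigma : R) F W (x : R) X : Prop :=
  [/\ adapted F X, continuous_paths X,
      forall (t : R) w, 0 <= t -> state_space (X t w),
      {ae P, forall w, X 0 w = x} &
      exists2 M : R -> T -> R,
        forall t : R, 0 <= t -> is_ito_integral F W (fun s w => sigma * X s w) t (M t) &
        forall t : R, 0 <= t -> {ae P, forall w,
          X t w = x + (\int[lebesgue_measure]_(s in `[0, t]) (mu * X s w)) + M t w}].

End processes.

Section equilibria.
Context d (T : measurableType d) (R : realType) (P : probability T R).
(* X x is the process started at x. *)
Variables (X : R -> R -> T -> R) (f delta : R -> R).
Implicit Types (x : R) (A : set R).

Definition hitting_time x A (w : T) : \bar R :=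
  ereal_inf [set t%:E | t in [set t : R | 0 < t /\ A (X x t w)]].

(* hitting_time is nonnegative, so the last case does not occur. *)
Definition stopped_payoff x A (w : T) : \bar R :=
  match hitting_time x A w with
  | t%:E => (delta t * f (X x t w))%:E
  | +oo%E => limf_esup (fun t : R => (delta t * f (X x t w))%:E) (pinfty_nbhs R)
  | -oo%E => 0%E
  end.

Definition J x A : \bar R := (\int[P]_w stopped_payoff x A w)%E.

Definition stop_set A : set R :=
  [set x | state_space x /\ (J x A < (f x)%:E)%E].

Definition indiff_set A : set R :=
  [set x | state_space x /\ (f x)%:E = J x A].

Definition Theta A : set R := stop_set A `|` (indiff_set A `&` A).

Definition equilibrium A : Prop :=
  [/\ measurable A, A `<=` state_space (R := R) & Theta A = A].

Definition V x A : \bar R := Order.max (f x)%:E (J x A).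

Definition optimal_equilibrium A : Prop :=
  equilibrium A /\
  forall x, state_space x -> forall B, equilibrium B -> (V x B <= V x A)%E.

Definition rel_closed A : Prop :=
  exists2 C : set R, closed C & A = C `&` state_space (R := R).

Definition Rstar : set R :=
  state_space (R := R) `&`
  \bigcap_(A in [set A | equilibrium A /\ rel_closed A]) A.

End equilibria.

(* Main.v *)
(** Proof idea.  For nu > 0 the process grows exponentially, so
    limsup X_t / (1 + beta t) is +oo with positive probability and
    J(x, set0) = +oo for every x.  Hence set0 is a closed equilibrium whose value
    function dominates every other one.

    Ito's formula is not used.  Fix a horizon tau, split it at q times t_k with
    step h, and write r_k for the relative increment of X over the k-th step.
    On an event of probability close to 1 all ratios X_s / X_{t_k} within a step
    lie in [1 - e, 1 + e]; there r_k is mu h + O(e h) plus a sum b_k of products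
    (integrand) * (increment of W) over a much finer grid, with an integrand
    bounded by sigma (1 + e).  Orthogonality of the increments gives
      E (sum b_k)^2 <= sigma^2 (1 + e)^2 tau,
      E (sum b_k^2) <= sigma^2 (1 + e)^2 tau.
    By the first bound and Chebyshev, sum b_k >= - e tau except with probability
    O(1 / tau); by the second and Markov, sum b_k^2 <= sigma^2 (1 + e)^3 tau with
    probability at least 1 - 1 / (1 + e).  Since
      ln (1 + r) >= r - (1/2 + e) r^2  for |r| <= e,
    ln X_tau is at least (mu - sigma^2 / 2 - O(e)) tau with a probability bounded
    below independently of tau, which is all that is needed. *)

Require Import Defs.
From mathcomp Require Import all_boot all_order all_algebra.
From mathcomp Require Import all_classical all_reals all_analysis.
From mathcomp Require Import measurable_realfun ring lra.
Import Order.TTheory GRing.Theory Num.Theory.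
Import numFieldNormedType.Exports.
Local Open Scope classical_set_scope.
Local Open Scope ring_scope.

Set Implicit Arguments.
Unset Strict Implicit.
Unset Printing Implicit Defensive.

(** * The first two moments of the normal distribution *)

Lemma integral_cst_probability d (T : measurableType d) (R : realType)
  (P : probability T R) (r : \bar R) : (\int[P]__ r = r)%E.
Proof.
by rewrite integral_cst//; rewrite [X in (_ * X)%E]probability_setT mule1.
Qed.

Section normal_moments.
Context {R : realType}.
Implicit Types (m s a : R).
Local Notation mu := (@lebesgue_measure R).

(** The change of variables formula is stated with a Radon-Nikodym derivative, determined only up to
    a null set. It equals [normal_pdf] almost everywhere because both have the same integral over
    every measurable set. *)
Lemma ge0_integral_normal_prob m s (f : R -> \bar R) :
  measurable_fun setT f -> (forall x, 0 <= f x)%E ->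
  (\int[normal_prob m s]_x f x =
   \int[mu]_x (f x * (normal_pdf m s x)%:E))%E.
Proof.
move=> mf f0.
have dom : normal_prob m s `<< mu := normal_prob_dominates m s.
rewrite -(Radon_Nikodym_SigmaFinite.change_of_variables dom)//.
have mRN := measurable_int _ (Radon_Nikodym_SigmaFinite.f_integrable dom).
have mpdf : measurable_fun setT (fun x => (normal_pdf m s x)%:E).
  by apply/measurable_EFinP; exact: measurable_normal_pdf.
apply: ge0_ae_eq_integral => //.
- exact: emeasurable_funM.
- exact: emeasurable_funM.
- by move=> x _; rewrite mule_ge0// Radon_Nikodym_SigmaFinite.f_ge0.
- by move=> x _; rewrite mule_ge0// lee_fin normal_pdf_ge0.
apply: (@filterS _ _ _ (fun x => setT x ->
  Radon_Nikodym_SigmaFinite.f (normal_prob m s) mu x = (normal_pdf m s x)%:E)).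
  by move=> x /(_ Logic.I) /= ->.
apply: integral_ae_eq => //.
  exact: Radon_Nikodym_SigmaFinite.f_integrable.
by move=> E _ mE; rewrite -Radon_Nikodym_SigmaFinite.f_integral.
Qed.

Lemma normal_prob_mgf s a : s != 0 ->
  (\int[normal_prob 0 s]_y (expR (a * y))%:E = (expR (a ^+ 2 * s ^+ 2 / 2))%:E)%E.
Proof.
move=> s0.
rewrite ge0_integral_normal_prob; last 2 first.
- apply/measurable_EFinP; apply: (measurableT_comp (@measurable_expR R)).
  by apply: measurable_funM.
- by move=> x; rewrite lee_fin expR_ge0.
(* Completing the square shifts the mean by a * s^2. *)
transitivity (\int[mu]_x ((expR (a ^+ 2 * s ^+ 2 / 2))%:E *
    (normal_pdf (a * s ^+ 2) s x)%:E))%E.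
  apply: eq_integral => x _; rewrite -!EFinM; congr (_%:E).
  rewrite !normal_pdfE//= /normal_fun mulrCA [RHS]mulrCA.
  congr (_ * _); rewrite -!expRD; congr expR.
  by rewrite -mulr_natr; field.
rewrite ge0_integralZl//; last 2 first.
- by apply/measurable_EFinP; exact: measurable_normal_pdf.
- by move=> x _; rewrite lee_fin normal_pdf_ge0.
- by rewrite integral_normal_pdf mule1.
Qed.

(** The difference of the two sides vanishes at 0, and its derivative [expR x + expR (- x) - 2] is
    nonnegative: add [1 + c <= expR c] and [1 - c <= expR (- c)]. *)
Lemma expR_subN_ge (u : R) : 0 <= u -> 2 * u <= expR u - expR (- u).
Proof.
move=> u0; pose h (x : R) := expR x - expR (- x) - 2 * x.
have dh (x : R) : is_derive x 1 h (expR x + expR (- x) - 2).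
  by apply: is_derive_eq; rewrite /GRing.scale/=; ring.
have [|c _] := MVT_segment u0 (fun x _ => dh x).
  apply: continuous_subspaceT => x.
  by apply/differentiable_continuous/derivable1_diffP; have [] := dh x.
rewrite /h /= oppr0 expR0 !(subrr, mulr0, subr0).
have := expR_ge1Dx c; have := expR_ge1Dx (- c).
nra.
Qed.

(** With [p = expR (v / 2)] and [q = expR (- (v / 2))] the right side is [(p - q) ^+ 2 + 2], and
    [p - q >= v] for [v >= 0]. *)
Lemma expR_addN_ge (v : R) : 2 + v ^+ 2 <= expR v + expR (- v).
Proof.
wlog v0 : v / 0 <= v.
  move=> H; have [/H//|/ltW v0] := leP 0 v.
  by rewrite -sqrrN -{2}(opprK v) [leRHS]addrC H// oppr_ge0.
have := @expR_subN_ge (v / 2) (divr_ge0 v0 (ler0n _ _)).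
set p := expR (v / 2); set q := expR (- (v / 2)) => pq.
have -> : expR v = p ^+ 2 by rewrite -expRM_natl -mulr_natl mulrC divfK.
have -> : expR (- v) = q ^+ 2.
  by rewrite -expRM_natl; congr expR; field.
have pq1 : p * q = 1 by rewrite -expRD subrr expR0.
have : v ^+ 2 <= (p - q) ^+ 2 by rewrite ler_sqr ?nnegrE//; lra.
by rewrite sqrrB pq1; lra.
Qed.

(* Both moments follow from the moment generating function: the second one from
   2 + a^2 y^2 <= expR (a y) + expR (- a y), the mean from 1 + a y <= expR (a y). *)
Lemma normal_prob_sqr s : s != 0 ->
  (\int[normal_prob 0 s]_y (y ^+ 2)%:E <= (s ^+ 2)%:E)%E.
Proof.
move=> s0; set I := (\int[_]_y _)%E.
have mexp a : measurable_fun [set: R] (fun y : R => expR (a * y)).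
  by apply: (measurableT_comp (@measurable_expR R)); exact: measurable_funM.
have I0 : (0 <= I)%E by apply: integral_ge0 => y _; rewrite lee_fin sqr_ge0.
have key a : (2%:E + (a ^+ 2)%:E * I <= (2 * expR (a ^+ 2 * s ^+ 2 / 2))%:E)%E.
  have -> : (2%:E + (a ^+ 2)%:E * I =
      \int[normal_prob 0 s]_y (2 + a ^+ 2 * y ^+ 2)%:E)%E.
    under eq_integral do rewrite EFinD EFinM.
    rewrite ge0_integralD//; last 2 first.
    - by move=> y _; rewrite -EFinM lee_fin mulr_ge0 ?sqr_ge0.
    - apply: emeasurable_funM => //.
      by apply/measurable_EFinP; exact: exprn_measurable.
    rewrite ge0_integralZl ?lee_fin ?sqr_ge0//; last 2 first.
    - by apply/measurable_EFinP; exact: exprn_measurable.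
    - by move=> y _; rewrite lee_fin sqr_ge0.
    by rewrite (integral_cst_probability (normal_prob 0 s)).
  have -> : (2 * expR (a ^+ 2 * s ^+ 2 / 2))%:E =
      (\int[normal_prob 0 s]_y (expR (a * y) + expR (- a * y))%:E)%E.
    under eq_integral do rewrite EFinD.
    rewrite ge0_integralD//; last 2 first.
    - by apply/measurable_EFinP; exact: mexp.
    - by apply/measurable_EFinP; exact: mexp.
    by rewrite !normal_prob_mgf// sqrrN -EFinD mulr2n mulrDl mul1r.
  apply: ge0_le_integral => //.
  - by move=> y _; rewrite lee_fin addr_ge0// mulr_ge0 ?sqr_ge0.
  - apply/measurable_EFinP; apply: measurable_funD => //.
    by apply: measurable_funM => //; exact: exprn_measurable.
  - by apply/measurable_EFinP; apply: measurable_funD; exact: mexp.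
  - by move=> y _; rewrite lee_fin -exprMn mulNr expR_addN_ge.
(* The case [a = 1] of [key] already bounds [I] by a real number. *)
have If : I \is a fin_num.
  rewrite ge0_fin_numE//; move: (key 1); rewrite expr1n mul1e.
  by case: (I) I0 => [r _ _||]//; rewrite ltry.
rewrite -(fineK If) lee_fin; set e := fine I.
have {}key a : 2 + a ^+ 2 * e <= 2 * expR (a ^+ 2 * s ^+ 2 / 2).
  by have := key a; rewrite -(fineK If) -EFinM -EFinD lee_fin.
have s2 : 0 < s ^+ 2 by rewrite exprn_even_gt0.
rewrite leNgt; apply/negP => se.
have es : 1 < e / s ^+ 2 by rewrite ltr_pdivlMr// mul1r.
have lnes : 0 < ln (e / s ^+ 2) by rewrite ln_gt0.
(* If s^2 < e then at a^2 = ln (e / s^2) / s^2 the bound key, combined with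
   expR u - 1 <= u * expR u, yields e <= s^2 * sqrt (e / s^2). *)
pose l := ln (e / s ^+ 2); pose a := Num.sqrt (l / s ^+ 2).
have a2 : a ^+ 2 = l / s ^+ 2 by rewrite sqr_sqrtr// divr_ge0 ?ltW.
have := key a; rewrite a2 mulfVK ?gt_eqF//.
have el : e = s ^+ 2 * expR l.
  by rewrite lnK ?posrE ?(lt_trans _ es)// mulrCA divff ?mulr1// gt_eqF.
rewrite {1}el mulrA mulfVK ?gt_eqF// => {}key.
have ub : expR (l / 2) - 1 <= l / 2 * expR (l / 2).
  have := expR_ge1Dx (- (l / 2)); rewrite expRN => H.
  have p0 := expR_gt0 (l / 2).
  rewrite lerBlDl -lerBlDr -[X in X - _]mul1r -mulrBl.
  by rewrite -ler_pdivlMr// mul1r.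
have l0 : 0 < l by [].
have El : expR (l / 2) < expR l by rewrite ltr_expR; lra.
have : 0 < l * (expR l - expR (l / 2)) by rewrite mulr_gt0// subr_gt0.
lra.
Qed.

Lemma normal_prob_integrable s : s != 0 ->
  (normal_prob 0 s).-integrable setT (fun y => y%:E).
Proof.
move=> s0; apply/integrableP; split; first exact: EFin_measurable.
apply: (@le_lt_trans _ _ (\int[normal_prob 0 s]_y (1 + y ^+ 2)%:E)%E).
  apply: ge0_le_integral => //.
  - by apply: measurableT_comp => //; exact: EFin_measurable.
  - by apply/measurable_EFinP; apply: measurable_funD.
  - move=> y _; rewrite lee_fin -[y ^+ 2]real_normK ?num_real//.
    have := sqr_ge0 (`|y| - 1); nra.
under eq_integral do rewrite EFinD.
rewrite ge0_integralD//; last 2 first.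
- by move=> y _; rewrite lee_fin sqr_ge0.
- by apply/measurable_EFinP; exact: exprn_measurable.
rewrite (integral_cst_probability (normal_prob 0 s)).
by rewrite lte_add_pinfty ?ltry// (le_lt_trans (normal_prob_sqr s0)) ?ltry.
Qed.

Lemma normal_prob_mean s : s != 0 -> (\int[normal_prob 0 s]_y y%:E = 0)%E.
Proof.
move=> s0; have iy := normal_prob_integrable s0.
have := integrable_fin_num measurableT iy => If.
rewrite -(fineK If); set e := fine _; congr (_%:E).
have key a : 1 + a * e <= expR (a ^+ 2 * s ^+ 2 / 2).
  rewrite -lee_fin -normal_prob_mgf// EFinD EFinM fineK//.
  rewrite -integralZl// -[X in (X + _)%E](integral_cst_probability (normal_prob 0 s)).
  rewrite -integralD//=.
  - apply: le_integral => //.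
    + apply: integrableD => //; first exact: finite_measure_integrable_cst.
      exact: integrableZl.
    + apply/integrableP; split.
        apply/measurable_EFinP; apply: (measurableT_comp (@measurable_expR R)).
        exact: measurable_funM.
      under eq_integral do rewrite gee0_abs ?lee_fin ?expR_ge0//.
      by rewrite normal_prob_mgf// ltry.
    + by move=> y _; rewrite -EFinM -EFinD lee_fin expR_ge1Dx.
  - exact: finite_measure_integrable_cst.
  - exact: integrableZl.
apply/eqP; apply: contraT => e0.
have e2 : 0 < e ^+ 2 by rewrite exprn_even_gt0.
have s2 : 0 < s ^+ 2 by rewrite exprn_even_gt0.
(* A nonzero mean [e] contradicts [key] at [a = t * e] for small [t]: the left side gains
   [t * e ^+ 2], of first order in [t], while the exponent [v = t ^+ 2 * w] is of second order. The
   choice [t = D^-1] is small enough for [expR v <= (1 - v)^-1] to conclude. *)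
pose w := e ^+ 2 * s ^+ 2 / 2.
have w0 : 0 < w by rewrite divr_gt0// mulr_gt0.
pose D := s ^+ 2 / 2 + w + 1.
have D1 : 1 < D by rewrite /D ltrDr addr_gt0// divr_gt0.
have D0 : 0 < D := lt_trans ltr01 D1.
pose t := D^-1.
have t0 : 0 < t by rewrite invr_gt0.
have t1 : t < 1 by rewrite invf_lt1.
have tD : t * D = 1 by rewrite mulVf// gt_eqF.
have := key (t * e); set v := (X in expR X) => kv.
have := expR_ge1Dx (- v); rewrite expRN => H.
have : (1 - v) * expR v <= 1.
  by rewrite -ler_pdivlMr ?expR_gt0// mul1r.
have vE : v = t * (t * w) by rewrite /v /w; field.
have tw : t * w < 1 by rewrite -tD ltr_pM2l// /D; nra.
have v1 : v < 1 by rewrite vE; nra.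
have ts : t * (s ^+ 2 / 2) + t * w = 1 - t.
  by rewrite -[in RHS]tD /D; ring.
move=> H2.
have H3 : (1 - v) * (1 + t * e * e) <= 1.
  by rewrite (le_trans _ H2)// ler_wpM2l// subr_ge0 ltW.
have : e ^+ 2 * (t * (1 - t * (s ^+ 2 / 2) - t * (t * w))) <= 0.
  rewrite (_ : _ * _ = (1 - v) * (1 + t * e * e) - 1) ?subr_le0//.
  by rewrite vE /w; field.
rewrite pmulr_rle0// pmulr_rle0//.
have : t * (t * w) <= t * w by rewrite ler_piMl// ltW// mulr_gt0.
lra.
Qed.
End normal_moments.

(** * Orthogonality of Brownian increments *)

Section sub_sigma_algebra.
Context d (T : measurableType d) (R : realType).
Implicit Types (G : set (set T)) (Y : T -> R).

(** Makes the closure properties of measurable functions available for measurability with respect to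
    a single member of the filtration. *)
Lemma measurable_wrt_fun G Y : sigma_algebra setT G ->
  measurable_wrt G Y <-> measurable_fun setT (Y : g_sigma_algebraType G -> R).
Proof.
move=> sG; split=> [GY _ B mB|mY B mB].
  by rewrite setTI; apply: sub_sigma_algebra; exact: GY.
by have := mY measurableT B mB; rewrite setTI /measurable/= sigma_algebra_id.
Qed.

Lemma measurable_wrt_le G G' Y :
  G `<=` G' -> measurable_wrt G Y -> measurable_wrt G' Y.
Proof. by move=> GG' GY B mB; exact/GG'/GY. Qed.

Lemma measurable_wrt_measurable G Y :
  G `<=` measurable -> measurable_wrt G Y -> measurable_fun setT Y.
Proof. by move=> Gm GY _ B mB; rewrite setTI; exact/Gm/GY. Qed.

End sub_sigma_algebra.

Section independence.
Context d (T : measurableType d) (R : realType) (P : probability T R).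

Lemma normal_law_moments (D : T -> R) (s : R) :
  measurable_fun setT D -> s != 0 ->
  (forall B : set R, measurable B -> P (D @^-1` B) = normal_prob 0 s B) ->
  [/\ P.-integrable setT (EFin \o D), (\int[P]_w (D w)%:E = 0)%E &
      (\int[P]_w (D w ^+ 2)%:E <= (s ^+ 2)%:E)%E].
Proof.
move=> mD s0 law.
have mD' : measurable_fun setT (D : T -> measurableTypeR R) := mD.
pose D' := @mfun_Sub _ _ T (measurableTypeR R) D (mem_set mD').
have lawE (f : R -> \bar R) :
    (\int[distribution P D']_y f y = \int[normal_prob 0 s]_y f y)%E.
  by apply: eq_measure_integral => B mB _; exact: law.
have iD : P.-integrable setT (EFin \o D).
  apply/integrableP; split; first exact/measurable_EFinP.
  rewrite -(ge0_integral_distribution D' (f := fun y => `|y%:E|%E))//.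
  - have /integrableP[_ +] := normal_prob_integrable s0.
    by rewrite lawE.
  - by apply: measurableT_comp => //; exact: EFin_measurable.
split=> //.
- rewrite -[LHS](integral_distribution (X := D') (f := EFin))//.
  by rewrite lawE normal_prob_mean.
- rewrite -(ge0_integral_distribution D' (f := fun y => (y ^+ 2)%:E))//.
  + by rewrite lawE normal_prob_sqr.
  + by apply/measurable_EFinP; exact: exprn_measurable.
  + by move=> y; rewrite lee_fin sqr_ge0.
Qed.

(** By independence the joint law of [(Z, D)] is the product of the marginal laws; by Fubini,
    integrating over [D] first leaves [z * 0] for each value [z] of [Z]. *)
Lemma independent_integral0 (G : set (set T)) (Z D : T -> R) :
  G `<=` measurable -> measurable_wrt G Z -> measurable_fun setT D ->
  (forall (A : set T) (B : set R), G A -> measurable B ->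
     P (A `&` D @^-1` B) = (P A * P (D @^-1` B))%E) ->
  P.-integrable setT (EFin \o D) -> (\int[P]_w (D w)%:E = 0)%E ->
  P.-integrable setT (fun w => (Z w * D w)%:E) ->
  (\int[P]_w (Z w * D w)%:E = 0)%E.
Proof.
move=> Gm GZ mD ind iD D0 iZD.
have mZ := measurable_wrt_measurable Gm GZ.
pose Z' : {mfun T >-> R} := mfun_Sub (mem_set mZ).
pose D' : {mfun T >-> R} := mfun_Sub (mem_set mD).
have mZD : measurable_fun setT (fun w => (Z w, D w)).
  exact/measurable_fun_pair.
pose ZD : {mfun T >-> (R * R)%type} := mfun_Sub (mem_set mZD).
pose g (z : R * R) := (z.1 * z.2)%:E.
have mg : measurable_fun setT g.
  apply/measurable_EFinP; apply: measurable_funM.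
    exact: measurable_fst.
  exact: measurable_snd.
have joint A : measurable A ->
    (distribution P Z' \x distribution P D')%E A = distribution P ZD A.
  move=> mA; apply: product_measure_unique => // B C mB mC.
  by rewrite /distribution /pushforward/= -ind//; exact: GZ.
have ig : (distribution P ZD).-integrable setT g.
  exact: (@integrable_pushforward _ _ _ _ _ _ mZD).
have ig' : (distribution P Z' \x distribution P D')%E.-integrable setT g.
  move/integrableP : ig => [_ ig]; apply/integrableP; split=> //.
  by rewrite (eq_measure_integral (distribution P ZD))// => A mA _; exact: joint.
rewrite -[LHS](integral_distribution (X := ZD) (f := g))//.
rewrite -(eq_measure_integral _ (fun A mA _ => joint A mA)).
rewrite -integral12_prod_meas1//.
rewrite (_ : fubini_F _ _ = cst 0%E) ?integral0//.
apply/funext => z; rewrite /fubini_F /g/=.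
under eq_integral do rewrite EFinM.
rewrite integralZl//.
  by rewrite (integral_distribution (X := D') (f := EFin))// ?D0 ?mule0//.
by apply: (@integrable_pushforward _ _ _ _ _ _ mD) => //; exact: EFin_measurable.
Qed.

Lemma ge0_integrable (f : T -> R) : measurable_fun setT f ->
  (forall w, 0 <= f w) -> (\int[P]_w (f w)%:E < +oo)%E ->
  P.-integrable setT (fun w => (f w)%:E).
Proof.
move=> mf f0 foo; apply/integrableP; split; first exact/measurable_EFinP.
by under eq_integral do rewrite gee0_abs ?lee_fin//.
Qed.

(** Induction on the number of terms: the cross term has mean 0, so second moments add up.
    Measurability of the partial sum is carried along because it is what makes the next increment
    independent of it. *)
Lemma brownian_sum_sqr (F : R -> set (set T)) (W : R -> T -> R)
    (s : nat -> R) (c : nat -> T -> R) (C : R) :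
  filtration F -> brownian_motion P F W ->
  0 <= s 0%N -> (forall j, s j < s j.+1) ->
  (forall j, measurable_wrt (F (s j)) (c j)) -> (forall j w, `|c j w| <= C) ->
  forall a k : nat,
  let Y w := \sum_(a <= j < a + k) c j w * (W (s j.+1) w - W (s j) w) in
  measurable_wrt (F (s (a + k)%N)) Y /\
  (\int[P]_w (Y w ^+ 2)%:E <= (C ^+ 2 * (s (a + k)%N - s a))%:E)%E.
Proof.
move=> [sF Fm Fle] [aW _ _ indW lawW] s00 sS mc cC a.
have s0 j : 0 <= s j by elim: j => // j /le_trans; apply; exact: ltW.
have sle i j : (i <= j)%N -> s i <= s j.
  by move=> /subnK <-; elim: (j - i)%N => // n /le_trans; apply; exact: ltW.
elim=> [|k [mY IH]] Y.
  rewrite /Y addn0 subrr mulr0; split.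
    apply/measurable_wrt_fun; first exact: sF.
    rewrite (_ : (fun _ => _) = cst 0); first exact: measurable_cst.
    by apply/funext => w; rewrite big_geq.
  by rewrite integral0_eq// => w _; rewrite big_geq// expr0n.
move: mY IH; set m := (a + k)%N; set Y0 := (fun w => _) => mY0 IH.
pose D w := W (s m.+1) w - W (s m) w.
have YE w : Y w = Y0 w + c m w * D w.
  by rewrite /Y addnS big_nat_recr ?leq_addr.
have wf t (f : T -> R) (t0 : 0 <= t) := measurable_wrt_fun f (sF t t0).
have mcm := mc m.
have mD : measurable_wrt (F (s m.+1)) D.
  apply/wf => //; apply: measurable_funB; apply/wf => //.
    exact: aW.
  by apply: (@measurable_wrt_le _ _ _ (F (s m))); [exact/Fle/ltW|exact: aW].
have le_m := Fle _ _ (s0 m) (ltW (sS m)).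
rewrite addnS -/m; split.
  apply/wf => //; rewrite (_ : Y = (fun w => Y0 w + c m w * D w)); last exact/funext.
  apply: measurable_funD; first exact/wf/(measurable_wrt_le le_m).
  by apply: measurable_funM; apply/wf => //; exact: measurable_wrt_le le_m _.
have mT t (f : T -> R) (t0 : 0 <= t) := @measurable_wrt_measurable _ _ _ _ f (Fm t t0).
have {mD} mD := mT _ _ (s0 _) mD.
have mcT := mT _ _ (s0 _) mcm.
have mYT := mT _ _ (s0 _) mY0.
have C0 : 0 <= C by rewrite (le_trans (normr_ge0 (c 0%N point)))// cC.
have d0 : 0 < s m.+1 - s m by rewrite subr_gt0.
have [iD D0 D2] : [/\ P.-integrable setT (EFin \o D), (\int[P]_w (D w)%:E = 0)%E &
    (\int[P]_w (D w ^+ 2)%:E <= (s m.+1 - s m)%:E)%E].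
  rewrite -[X in (_ <= X%:E)%E](sqr_sqrtr (ltW d0)).
  apply: normal_law_moments => //; first by rewrite gt_eqF// sqrtr_gt0.
  exact: lawW.
have iD2 : P.-integrable setT (fun w => (C ^+ 2 * D w ^+ 2)%:E).
  under eq_fun do rewrite EFinM.
  apply: integrableZl => //; apply: ge0_integrable.
  - exact: measurable_funX.
  - by move=> w; exact: sqr_ge0.
  - by rewrite (le_lt_trans D2)// ltry.
have cD2 w : (c m w * D w) ^+ 2 <= C ^+ 2 * D w ^+ 2.
  rewrite exprMn ler_wpM2r ?sqr_ge0// -real_normK ?num_real//.
  by rewrite lerXn2r ?nnegrE.
have icD2 : P.-integrable setT (fun w => ((c m w * D w) ^+ 2)%:E).
  apply: le_integrable iD2 => //.
  - by apply/measurable_EFinP/measurable_funX; exact: measurable_funM.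
  - move=> w _; rewrite lee_fin !ger0_norm ?sqr_ge0//.
    by rewrite mulr_ge0 ?sqr_ge0.
have iY2 : P.-integrable setT (fun w => (Y0 w ^+ 2)%:E).
  apply: ge0_integrable => [|w|]; first exact: measurable_funX.
    exact: sqr_ge0.
  by rewrite (le_lt_trans IH)// ltry.
(* The cross term is dominated by the sum of the two squares. *)
have iYc : P.-integrable setT (fun w => (Y0 w * c m w * D w)%:E).
  apply: (@le_integrable _ _ _ _ _ measurableT _
    (fun w => ((Y0 w ^+ 2)%:E + ((c m w * D w) ^+ 2)%:E)%E)).
  - by apply/measurable_EFinP; do 2 apply: measurable_funM => //.
  - move=> w _; rewrite -EFinD lee_fin -mulrA [leRHS]ger0_norm ?addr_ge0 ?sqr_ge0//.
    rewrite ler_norml; set u := Y0 w; set v := c m w * D w.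
    have := sqr_ge0 (u + v); have := sqr_ge0 (u - v).
    have := sqr_ge0 u; have := sqr_ge0 v.
    by move=> *; apply/andP; split; nra.
  - exact: integrableD.
(* [Y0 * c m] is known at time [s m], hence independent of the centred increment [D]. *)
have ort : (\int[P]_w (Y0 w * c m w * D w)%:E = 0)%E.
  apply: (independent_integral0 (Fm _ (s0 m)) (Z := fun w => Y0 w * c m w)) => //.
  - by apply/wf => //; apply: measurable_funM; exact/wf.
  - by move=> A B FA mB; exact: indW.
have -> : (\int[P]_w (Y w ^+ 2)%:E = \int[P]_w (Y0 w ^+ 2)%:E +
    \int[P]_w ((c m w * D w) ^+ 2)%:E)%E.
  transitivity (\int[P]_w ((Y0 w ^+ 2)%:E + ((c m w * D w) ^+ 2)%:E +
      2%:E * (Y0 w * c m w * D w)%:E))%E.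
    apply: eq_integral => w _; rewrite -EFinM -!EFinD YE sqrrD; congr (_%:E).
    by rewrite -mulr_natl; ring.
  rewrite integralD//; last 2 first.
  - exact: integrableD.
  - exact: integrableZl.
  by rewrite integralD// integralZl// ort mule0 adde0.
have -> : C ^+ 2 * (s m.+1 - s a) =
    C ^+ 2 * (s m - s a) + C ^+ 2 * (s m.+1 - s m) by ring.
rewrite EFinD leeD//.
apply: (@le_trans _ _ (\int[P]_w (C ^+ 2 * D w ^+ 2)%:E)%E).
  by apply: le_integral => // w _; rewrite lee_fin.
under eq_integral do rewrite EFinM.
rewrite ge0_integralZl//; last 3 first.
- by apply/measurable_EFinP; exact: measurable_funX.
- by move=> w _; rewrite lee_fin sqr_ge0.
- by rewrite lee_fin sqr_ge0.
by rewrite [leRHS]EFinM; apply: lee_wpmul2l => //; rewrite lee_fin sqr_ge0.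
Qed.

End independence.

(** * Estimates on real functions *)

Section real_estimates.
Context {R : realType}.

(** The difference [g] of the two sides has derivative [x * ((1 + 2 * e) - (1 + x)^-1)], which has
    the sign of [x] on [[- e, e]]; so [g] is least at 0, where it vanishes. *)
Lemma ln1D_ge (r e : R) : 0 < e -> e <= 1 / 2 -> `|r| <= e ->
  r - (1 / 2 + e) * r ^+ 2 <= ln (1 + r).
Proof.
move=> e0 e2; rewrite ler_norml => /andP[er re].
pose g (x : R) := ln (1 + x) - x + (1 / 2 + e) * x ^+ 2.
pose g' (x : R) := (1 + x)^-1 - 1 + (1 + 2 * e) * x.
have dg x : - e <= x -> x <= e -> is_derive x 1 g (g' x).
  move=> ex xe; have x1 : 0 < 1 + x by lra.
  have dl : is_derive (1 + x) 1 (@ln R) (1 + x)^-1 by exact: is_derive1_ln.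
  have d1 : is_derive x 1 (fun x => ln (1 + x)) (1 + x)^-1.
    have d2 : is_derive x 1 (cst 1 + id : R -> R) 1.
      by apply: is_derive_eq; rewrite add0r.
    have -> : (fun x => ln (1 + x)) = (@ln R) \o (cst 1 + id) by [].
    by rewrite -[(1 + x)^-1]mulr1; exact: is_derive1_comp.
  rewrite /g /g'; apply: is_derive_eq; rewrite /GRing.scale/=; lra.
have g'E x : - e <= x -> x <= e -> g' x = x * ((1 + 2 * e) - (1 + x)^-1).
  by move=> ex xe; rewrite /g'; field; apply/eqP; lra.
have g'1 x : - e <= x -> x <= e -> 0 <= (1 + 2 * e) - (1 + x)^-1.
  (* The worst case is [x = - e], where [(1 + 2 * e) * (1 - e) >= 1] amounts to [e <= 1 / 2]. *)
  move=> ex xe; rewrite subr_ge0 -[leLHS]mul1r ler_pdivrMr; last by lra.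
  nra.
suff : 0 <= g r by rewrite /g; lra.
have g0 : g 0 = 0 by rewrite /g addr0 ln1 expr0n/= mulr0 subr0 addr0.
have cg (a b : R) : - e <= a -> b <= e -> {within `[a, b], continuous g}.
  move=> ea be; apply: derivable_within_continuous => x.
  rewrite in_itv/= => /andP[ax xb].
  by have [] := dg x (le_trans ea ax) (le_trans xb be).
have [r0|/ltW r0] := leP 0 r.
- have [x| |] := MVT_segment r0 (f := g) (df := g').
  + by rewrite in_itv/= => /andP[/ltW ? /ltW ?]; apply: dg; lra.
  + by apply: cg => //; lra.
  + move=> c; rewrite in_itv/= => /andP[c0 cr]; rewrite g0 !subr0 => ->.
    rewrite mulr_ge0// g'E; [|lra|lra].
    by rewrite mulr_ge0// g'1//; lra.
- have [x| |] := MVT_segment r0 (f := g) (df := g').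
  + by rewrite in_itv/= => /andP[/ltW ? /ltW ?]; apply: dg; lra.
  + by apply: cg => //; lra.
  + move=> c; rewrite in_itv/= => /andP[c0 cr]; rewrite g0 !sub0r => /eqP.
    rewrite eqr_oppLR => /eqP ->.
    rewrite g'E; [|lra|lra].
    rewrite -mulrN opprK; have := g'1 c; set k := (_ - _) => k0.
    by rewrite mulrAC mulr_ge0 ?k0 ?mulr_le0//; lra.
Qed.

(** Sums the logarithmic bound over the steps. Here [r] is the relative increment, [d] its drift
    part, close to [m * h], and [b] its martingale part; only the sum of [b] and the sum of its
    squares are controlled. *)
Lemma sum_ln1D_ge (n : nat) (r b d : nat -> R) (m e h t Q : R) :
  0 < e -> e <= 1 / 2 -> 0 <= m -> 0 <= h -> n%:R * h = t ->
  (forall i, (i < n)%N -> `|r i| <= e) ->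
  (forall i, (i < n)%N -> r i = d i + b i) ->
  (forall i, (i < n)%N -> `|d i - m * h| <= 2 * m * e * h) ->
  - e * t <= \sum_(i < n) b i -> \sum_(i < n) b i ^+ 2 <= Q ->
  m * (1 - 2 * e) * t - e * t
    - (1 / 2 + e) * ((1 + e) * Q + (1 + e^-1) * (2 * m * h) ^+ 2 * n%:R)
  <= \sum_(i < n) ln (1 + r i).
Proof.
move=> e0 e2 m0 h0 nh re rE dE bt bQ.
have mh0 : 0 <= m * h by rewrite mulr_ge0.
apply: (@le_trans _ _ (\sum_(i < n) (m * (1 - 2 * e) * h + b i - (1 / 2 + e) *
   ((1 + e) * b i ^+ 2 + (1 + e^-1) * (2 * m * h) ^+ 2)))); last first.
  apply: ler_sum => i _; apply: le_trans (ln1D_ge e0 e2 (re i (ltn_ord i))).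
  have := dE i (ltn_ord i); rewrite rE//.
  move: (b i) (d i) => x y; rewrite ler_norml => /andP[yl yu].
  have meh : m * e * h <= m * h / 2 by nra.
  have y0 : 0 <= y by lra.
  have y2 : y <= 2 * m * h by lra.
  have ysq : y ^+ 2 <= (2 * m * h) ^+ 2 by rewrite lerXn2r ?nnegrE//; lra.
  have e1 : 0 < e^-1 by rewrite invr_gt0.
  (* Young's inequality with weight [e]: the coefficient of the martingale square stays close to 1,
     and the large factor [1 + e^-1] falls on the drift square, which is of order [h ^+ 2]. *)
  have xy : (y + x) ^+ 2 <= (1 + e) * x ^+ 2 + (1 + e^-1) * y ^+ 2.
    have : 0 <= e * (x - e^-1 * y) ^+ 2 by rewrite mulr_ge0 ?sqr_ge0// ltW.
    have -> : e * (x - e^-1 * y) ^+ 2 = e * x ^+ 2 - 2 * x * y + e^-1 * y ^+ 2.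
      by field; apply/eqP; lra.
    by rewrite sqrrD -mulr_natl; lra.
  have : (1 + e^-1) * y ^+ 2 <= (1 + e^-1) * (2 * m * h) ^+ 2.
    by rewrite ler_wpM2l//; lra.
  move: (_ ^+ 2) xy => u xy; nra.
rewrite sumrB big_split/= sumr_const card_ord -mulr_sumr big_split/= sumr_const.
rewrite card_ord -mulr_sumr -[_ * h *+ n]mulr_natr -[_ * _ ^+ 2 *+ n]mulr_natr -nh.
set K := 1 / 2 + e; have K0 : 0 <= K by rewrite /K; lra.
have : K * ((1 + e) * \sum_(i < n) b i ^+ 2) <= K * ((1 + e) * Q).
  by rewrite ler_wpM2l// ler_wpM2l//; lra.
move: bt; rewrite -nh; lra.
Qed.

End real_estimates.

(** * Continuous paths on a bounded time interval *)

Section paths.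
Context {R : realType}.

(** Compactness of [[0, t]] in its near-covering form. Only [u] is confined to the segment, [v] may
    lie slightly beyond [t]. *)
Lemma uniform_continuous_segment (g : R -> R) (t e : R) :
  {within `[0, +oo[, continuous g} -> 0 < e ->
  exists2 r : R, 0 < r & forall u v, 0 <= u <= t -> 0 <= v ->
    `|u - v| < r -> `|g u - g v| < e.
Proof.
move=> /subspace_continuousP cg e0.
pose Q (r u : R) := 0 <= u -> forall v, 0 <= v -> `|u - v| < r -> `|g u - g v| < e.
have /compact_near_coveringP cov := @segment_compact R 0 t.
have H : \forall r \near 0^'+, `[0, t]%classic `<=` Q r.
  apply: cov => x /=; rewrite in_itv/= => /andP[x0 xt].
  have e2 : 0 < e / 2 by rewrite divr_gt0.
  have gx : (`[0, +oo[%classic : set R) x by rewrite /= in_itv/= x0.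
  have /cvgrPdist_lt/(_ _ e2)/nbhs_ballP[r /= r0 xr] := cg x gx.
  have r2 : 0 < r / 2 by rewrite divr_gt0.
  exists (ball x (r / 2), [set q : R | 0 < q < r / 2]); first split => /=.
  - exact: nbhsx_ballx.
  - apply: filterS2 (nbhs_right_gt 0) (nbhs_right_lt r2).
    by move=> q q0 qr; rewrite /= q0 qr.
  - move=> [u q] [/= xu /andP[q0 qr]] u0 v v0 uv.
    have gu : `|g x - g u| < e / 2.
      apply: xr; last by rewrite /= in_itv/= u0.
      by apply: le_ball xu; rewrite ler_pdivrMr// ler_pMr// ler1n.
    have gv : `|g x - g v| < e / 2.
      apply: xr; last by rewrite /= in_itv/= v0.
      move: xu; rewrite /ball/= => xu.
      rewrite (_ : x - v = (x - u) + (u - v)); last by ring.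
      by rewrite (le_lt_trans (ler_normD _ _))// (splitr r) ltrD// (lt_trans uv).
    rewrite (_ : g u - g v = - (g x - g u) + (g x - g v)); last by ring.
    by rewrite (le_lt_trans (ler_normD _ _))// normrN (splitr e) ltrD.
near (0 : R)^'+ => r.
have r0 : 0 < r by near: r; exact: nbhs_right_gt.
have Qr : `[0, t]%classic `<=` Q r by near: r.
exists r => // u v /andP[u0 ut]; apply: Qr => //=.
by rewrite in_itv/= u0.
Unshelve. all: by end_near. Qed.

(** The difference of the integrals is the integral over []a, b]], where [g] may be frozen at [y].
    This will extract the drift of one time step. *)
Lemma Rintegral_increment (g : R -> R) (a b y e : R) : 0 <= a -> a <= b ->
  {within `[0, b], continuous g} -> (forall s, a < s <= b -> `|g s - y| <= e) ->
  `|\int[lebesgue_measure]_(s in `[0, b]) g s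
    - \int[lebesgue_measure]_(s in `[0, a]) g s - y * (b - a)| <= e * (b - a).
Proof.
move=> a0 ab cg ge.
have ig : lebesgue_measure.-integrable `[0, b] (EFin \o g).
  by apply: continuous_compact_integrable => //; exact: segment_compact.
rewrite Rintegral_itvB ?bnd_simp//.
have mab : measurable (`]a, b] : set (measurableTypeR R)) by exact: measurable_itv.
have leb : fine (lebesgue_measure (`]a, b] : set R)) = b - a.
  rewrite lebesgue_measure_itv/= lte_fin.
  by case: ltgtP ab => //= ->; rewrite subrr.
have fleb : (lebesgue_measure (`]a, b] : set R) < +oo)%E.
  by rewrite lebesgue_measure_itv/=; case: ifPn; rewrite ltry.
have icst (r : R) : lebesgue_measure.-integrable (`]a, b] : set R) (EFin \o cst r).
  apply/integrableP; split; first by apply/measurable_EFinP; exact: measurable_cst.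
  by rewrite (eq_integral (cst `|r|%:E))// integral_cst//= lte_mul_pinfty.
have iab : lebesgue_measure.-integrable `]a, b] (EFin \o g).
  apply: integrableS ig => // s /=; rewrite !in_itv/= => /andP[as_ ->].
  by rewrite andbT (le_trans a0)// ltW.
have -> : y * (b - a) = \int[lebesgue_measure]_(s in `]a, b]) (cst y s).
  by rewrite Rintegral_cst// leb.
rewrite -RintegralB//; have igy : lebesgue_measure.-integrable `]a, b]
    (EFin \o (fun s => g s - cst y s)).
  by have := integrableB mab iab (icst y); exact: eq_integrable.
apply: le_trans (le_normr_Rintegral _ _) _ => //.
have -> : e * (b - a) = \int[lebesgue_measure]_(s in `]a, b]) (cst e s).
  by rewrite Rintegral_cst// leb.
apply: le_Rintegral => //; first exact: integrable_norm.
Qed.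

(** [j.+1] is the ceiling of [y]; the cells []j, j.+1]] are open on the left like the intervals of a
    simple process. *)
Lemma nat_ceil_exists (y : R) (n : nat) : 0 < y -> y <= n%:R ->
  exists2 j, (j < n)%N & j%:R < y <= j.+1%:R.
Proof.
elim: n => [|n IH] y0 yn; first by move: (lt_le_trans y0 yn); rewrite ltxx.
have [/(IH y0)[j jn jy]|ny] := leP y n%:R; last by exists n; rewrite // ny.
by exists j => //; rewrite ltnS ltnW.
Qed.

End paths.

(** * Riemann sums for the Ito integral *)

Section uniform_grid.
Context d (T : measurableType d) (R : realType) (P : probability T R).

(** The tails [B n], the unions of the [A m] with [m >= n], decrease to the empty set, so continuity
    from above applies. *)
Lemma cvg_probability_eventually_empty (A : nat -> set T) :
  (forall m, measurable (A m)) ->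
  (forall w, exists m0, forall m, (m0 <= m)%N -> ~ A m w) ->
  P (A m) @[m --> \oo] --> 0%E.
Proof.
move=> mA Aw; pose B n := \bigcup_(m in [set m | (n <= m)%N]) A m.
have mB n : measurable (B n) by exact: bigcup_measurable.
have capB : \bigcap_n B n = set0.
  apply/seteqP; split => // w /= Bw; have [m0 Am0] := Aw w.
  by have [m /= m0m] := Bw m0 Logic.I; exact: Am0.
have PB : (P \o B) @ \oo --> 0%E.
  rewrite -[X in _ --> X](measure0 P) -capB; apply: nonincreasing_cvg_mu => //.
  - by rewrite (le_lt_trans (probability_le1 _ (mB 0%N)))// ltry.
  - by rewrite capB.
  - move=> m n mn; apply/subsetPset => w [k /= nk Akw].
    by exists k => //=; exact: leq_trans nk.
apply: (squeeze_cvge _ (cvg_cst _) PB); near=> n; apply/andP; split => //=.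
apply: le_measure; rewrite ?inE//.
by move=> w Anw; exists n => /=.
Unshelve. all: by end_near. Qed.

Variables (F : R -> set (set T)) (H : R -> T -> R).
Hypotheses (hF : filtration F) (aH : adapted F H) (cH : continuous_paths H).
Variables (tau : R) (tau0 : 0 < tau).

(** For [N = 0] division by zero yields 0 and all grid times are 0, so nonnegativity and
    monotonicity hold for every [N]. *)
Definition grid_time (N j : nat) : R := j%:R * (tau / N%:R).

Lemma grid_time_ge0 N j : 0 <= grid_time N j.
Proof. by rewrite mulr_ge0// divr_ge0// ltW. Qed.

Lemma grid_time_nd N j : grid_time N j <= grid_time N j.+1.
Proof. by rewrite ler_wpM2r ?ler_nat// divr_ge0// ltW. Qed.

Lemma grid_step_gt0 N : (0 < N)%N -> 0 < tau / N%:R.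
Proof. by move=> N0; rewrite divr_gt0// ltr0n. Qed.

Lemma grid_time_le N j : (0 < N)%N -> (j <= N)%N -> grid_time N j <= tau.
Proof.
move=> N0 jN; rewrite /grid_time mulrCA ger_pMr// ler_pdivrMr ?ltr0n//.
by rewrite mul1r ler_nat.
Qed.

(** The coefficients, inferred from the type of the measurability proof, are the values of [H] at
    the left ends of the cells. *)
Definition grid_process N : simple_process F :=
  SimpleProcess N (grid_time_ge0 N) (grid_time_nd N)
    (fun j => aH (grid_time_ge0 N j)).

Lemma grid_process_valE N (s : R) w : (0 < N)%N -> 0 < s <= tau ->
  exists j, [/\ (j < N)%N, grid_time N j < s <= grid_time N j.+1 &
    sp_val (grid_process N) s w = H (grid_time N j) w].
Proof.
move=> N0 /andP[s0 st]; have h0 := grid_step_gt0 N0.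
have [||j jN jy] := @nat_ceil_exists _ (s / (tau / N%:R)) N.
- by rewrite divr_gt0.
- by rewrite ler_pdivrMr// mulrC divfK// pnatr_eq0 -lt0n.
have gE i : (grid_time N i < s <= grid_time N i.+1) =
    (i%:R < s / (tau / N%:R) <= i.+1%:R).
  by rewrite ltr_pdivlMr// ler_pdivrMr.
exists j; split => //; first by rewrite gE.
rewrite /sp_val (bigD1 (Ordinal jN))//= [X in _ + X]big1 ?addr0 => [|i ij].
  by rewrite indicE mem_set ?mulr1//= in_itv/= gE.
rewrite indicE memNset ?mulr0//= in_itv/= gE => /andP[iy yi].
case/andP: jy => jy yj; move: ij; rewrite -val_eqE/= neq_ltn => /orP[].
- by rewrite -(ler_nat R) => /(le_trans yi)/le_lt_trans/(_ jy); rewrite ltxx.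
- by rewrite -(ler_nat R) => /(le_trans yj)/le_lt_trans/(_ iy); rewrite ltxx.
Qed.

Lemma grid_process_unif w (e : R) : 0 < e -> exists N0 : nat,
  forall N, (0 < N)%N -> (N0 <= N)%N -> forall s, 0 < s <= tau ->
    `|H s w - sp_val (grid_process N) s w| < e.
Proof.
move=> e0; have [r r0 Hr] := uniform_continuous_segment tau (@cH w) e0.
(* From this index on the mesh [tau / N] is below the modulus of continuity [r] of the path. *)
exists (Num.truncn (tau / r)).+1 => N N0 NN s sI.
have [j [jN /andP[js sj] ->]] := grid_process_valE w N0 sI.
case/andP: sI => s0 st; apply: Hr.
- by rewrite ltW.
- exact: grid_time_ge0.
- rewrite gtr0_norm ?subr_gt0// ltrBlDr (le_lt_trans sj)//.
  rewrite /grid_time -natr1 mulrDl mul1r addrC ltrD2r.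
  rewrite ltr_pdivrMr ?ltr0n// mulrC -ltr_pdivrMr//.
  by rewrite (lt_le_trans (truncnS_gt _))// ler_nat.
Qed.

Lemma measurable_indic_fst (I : interval R) : measurable_fun setT
  (fun z : measurableTypeR R * T => \1_[set` I] z.1 : R).
Proof.
have mI : measurable_fun [set: measurableTypeR R] (\1_[set` I] : R -> R).
  by apply: measurable_indic; exact: measurable_itv.
by apply: (measurableT_comp mI); exact: measurable_fst.
Qed.

Lemma grid_process_measurable N : measurable_fun setT
  (fun z : measurableTypeR R * T => sp_val (grid_process N) z.1 z.2).
Proof.
rewrite /sp_val; apply: measurable_sum => j; apply: measurable_funM.
  apply: (measurableT_comp (f := H (grid_time N j))); last exact: measurable_snd.
  have [_ Fm _] := hF.
  apply: measurable_wrt_measurable (aH (grid_time_ge0 N j)).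
  exact/Fm/grid_time_ge0.
exact: measurable_indic_fst.
Qed.

(** On each path the grid processes converge uniformly, so the integrated square error is eventually
    below [e]; convergence in probability follows. The condition [m < N_ m] forces the mesh to 0. *)
Lemma grid_process_approximates (t : R) (N_ : nat -> nat) : 0 <= t -> t <= tau ->
  (forall m, (m < N_ m)%N) -> approximates P H t (fun m => grid_process (N_ m)).
Proof.
move=> t0 ttau mN e e0.
have N0 m : (0 < N_ m)%N by rewrite (leq_ltn_trans _ (mN m)).
(* Joint measurability in time and [w] comes from cutting [H] off to []0, tau]]: the result is a
   pointwise limit of grid processes. By Tonelli the integrated error [Z] is then measurable in
   [w]. *)
pose G m (z : measurableTypeR R * T) :=
  (H z.1 z.2 * \1_(`]0, tau]%classic : set R) z.1 - sp_val (grid_process (N_ m)) z.1 z.2) ^+ 2.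
have mG m : measurable_fun setT (G m).
  apply: measurable_funX; apply: measurable_funB; last exact: grid_process_measurable.
  apply: (measurable_fun_cvg (h := fun k (z : measurableTypeR R * T) =>
    sp_val (grid_process k.+1) z.1 z.2)).
  - by move=> k; exact: grid_process_measurable.
  - move=> [s w] _ /=.
    have [sI|sI] := boolP (0 < s <= tau).
      rewrite indicE mem_set/= ?in_itv// mulr1; apply/cvgrPdist_lt => q q0.
      have [k0 Hk] := grid_process_unif w q0.
      by exists k0 => // k /= kk; apply: Hk => //; exact: leqW.
    rewrite indicE memNset/= ?in_itv ?(negbTE sI)// mulr0.
    rewrite (_ : (fun _ => _) = cst 0); first exact: cvg_cst.
    apply/funext => k /=; rewrite /sp_val big1// => i _.
    rewrite indicE memNset ?mulr0//= in_itv/= => /andP[gs sg].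
    move/negP: sI; apply; rewrite (le_lt_trans (grid_time_ge0 k.+1 i) gs)/=.
    by rewrite (le_trans sg)// grid_time_le.
pose Z m := fubini_G lebesgue_measure
  (fun z : measurableTypeR R * T => (G m z * \1_(`]0, t]%classic : set R) z.1)%:E).
have mZ m : measurable_fun setT (Z m).
  apply: measurable_fun_fubini_tonelli_G.
    apply/measurable_EFinP; apply: measurable_funM => //.
    exact: measurable_indic_fst.
  by move=> z; rewrite lee_fin mulr_ge0// sqr_ge0.
have GE m s w : s \in (`]0, t]%classic : set R) ->
    (H s w - sp_val (grid_process (N_ m)) s w) ^+ 2 = G m (s, w).
  rewrite inE/= in_itv/= => /andP[s0 st].
  by rewrite /G/= indicE mem_set ?mulr1//= in_itv/= s0 (le_trans st).
have mGw m w : measurable_fun setT (fun s : measurableTypeR R => G m (s, w)).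
  exact: measurable_fun_pair1.
have ZE m w : (\int[lebesgue_measure]_(s in `[0%R, t])
    ((H s w - sp_val (grid_process (N_ m)) s w) ^+ 2)%:E = Z m w)%E.
  (* Time 0 has to be dropped: there the simple process is 0 while [H] need not be, so the error
     differs from [G] at that null point. *)
  rewrite -integral_itv_obnd_cbnd; last first.
    apply/measurable_EFinP.
    apply: (eq_measurable_fun (fun s => G m (s, w))) => [s sI|].
      by rewrite -GE.
    exact: measurable_funTS.
  rewrite integral_mkcond /Z /fubini_G; apply: eq_integral => s _.
  rewrite patchE; case: ifPn => sI; first by rewrite GE// indicE sI mulr1.
  by rewrite indicE (negbTE sI) mulr0.
under eq_fun do under eq_set do rewrite ZE.
apply: cvg_probability_eventually_empty => [m|w].
  by rewrite -[X in measurable X]setTI; exact: emeasurable_fun_c_infty.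
(* A uniform error below [q] gives an integral of at most [q ^+ 2 * t], which is less than [e], also
   when [t = 0]. *)
pose q := Num.sqrt (e / (t + 1)).
have t1 : 0 < t + 1 by rewrite ltr_wpDl.
have q0 : 0 < q by rewrite sqrtr_gt0 divr_gt0.
have q2 : q ^+ 2 = e / (t + 1) by rewrite sqr_sqrtr// ltW// divr_gt0.
have [n0 Hn] := grid_process_unif w q0.
exists n0 => m mn /=; apply/negP; rewrite -ltNge -ZE.
rewrite -integral_itv_obnd_cbnd; last first.
  apply/measurable_EFinP.
  apply: (eq_measurable_fun (fun s => G m (s, w))) => [s sI|].
    by rewrite -GE.
  exact: measurable_funTS.
apply: (@le_lt_trans _ _ (\int[lebesgue_measure]_(s in `]0%R, t]) (q ^+ 2)%:E)%E).
  apply: ge0_le_integral => //.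
  - by move=> s _; rewrite lee_fin sqr_ge0.
  - apply/measurable_EFinP.
    apply: (eq_measurable_fun (fun s => G m (s, w))) => [s sI|].
      by rewrite -GE.
    exact: measurable_funTS.
  - move=> s /=; rewrite in_itv/= => /andP[s0 st].
    rewrite lee_fin -real_normK ?num_real// lerXn2r ?nnegrE// ?(ltW q0)// ltW//.
    apply: Hn => //; last by rewrite s0 (le_trans st).
    by rewrite (leq_trans mn)// ltnW.
rewrite integral_cst//= lebesgue_measure_itv/=.
case: ifPn => [_|_]; last by rewrite mule0 lte_fin.
rewrite oppr0 adde0 -EFinM lte_fin q2 -mulrA gtr_pMr// mulrC ltr_pdivrMr// mul1r.
by rewrite ltrDl.
Qed.

End uniform_grid.

(** * Uniform regularity of positive continuous paths *)

Lemma measurable_le_set d (T : measurableType d) (R : realType) (f g : T -> R) :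
  measurable_fun setT f -> measurable_fun setT g ->
  measurable [set w | f w <= g w].
Proof.
move=> mf mg.
rewrite (_ : [set _ | _] = setT `&` [set w | (0 <= (g w - f w)%:E)%E]).
  by apply: emeasurable_fun_c_infty => //; exact/measurable_EFinP/measurable_funB.
by apply/seteqP; split=> [w /=|w /= []]; rewrite lee_fin subr_ge0.
Qed.

Section regular_paths.
Context d (T : measurableType d) (R : realType) (P : probability T R).
Variables (X : R -> T -> R) (tau e : R).
Hypotheses (mX : forall t, 0 <= t -> measurable_fun setT (X t)).
Hypotheses (cX : continuous_paths X) (X0 : forall t w, 0 <= t -> 0 < X t w).
Hypotheses (tau0 : 0 < tau) (e0 : 0 < e).
Local Notation g := (grid_time tau).

(* Only rational fractions of tau are compared, so that the event is
   measurable. *)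
Definition regular_event (n : nat) : set T := [set w | forall N j M i : nat,
  [&& (0 < N)%N, (j <= N)%N, (0 < M)%N & (i <= M)%N] ->
  n.+1%:R^-1 <= X (g N j) w /\
  (`|g N j - g M i| <= tau / n.+1%:R ->
   `|X (g N j) w - X (g M i) w| <= e * X (g M i) w)].

Lemma measurable_regular_event n : measurable (regular_event n).
Proof.
pose B N j M i : set T := [set w |
  [&& (0 < N)%N, (j <= N)%N, (0 < M)%N & (i <= M)%N] ->
  n.+1%:R^-1 <= X (g N j) w /\
  (`|g N j - g M i| <= tau / n.+1%:R ->
   `|X (g N j) w - X (g M i) w| <= e * X (g M i) w)].
rewrite (_ : regular_event n =
    \bigcap_N \bigcap_j \bigcap_M \bigcap_i B N j M i); last first.
  apply/seteqP; split => [w H N _ j _ M _ i _|w H N j M i]; first exact: H.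
  exact: H.
do 4 (apply: bigcapT_measurable => ?).
rewrite /B; set c := [&& _, _, _ & _]; case: c; last first.
  by rewrite (_ : [set _ | _] = setT)//; apply/seteqP; split.
have mg N j : measurable_fun setT (X (g N j)) by apply/mX/grid_time_ge0.
set u := g _ _; set v := g _ _.
have mu : measurable_fun setT (X u) by exact: mg.
have mv : measurable_fun setT (X v) by exact: mg.
have m1 : measurable [set w | n.+1%:R^-1 <= X u w].
  exact: (measurable_le_set (f := cst n.+1%:R^-1)).
have m2 : measurable [set w | `|X u w - X v w| <= e * X v w].
  apply: measurable_le_set; last exact: measurable_funM.
  by apply: measurableT_comp => //; exact: measurable_funB.
case: (`|u - v| <= _).
  rewrite (_ : [set _ | _] = [set w | n.+1%:R^-1 <= X u w] `&`
      [set w | `|X u w - X v w| <= e * X v w]); first exact: measurableI.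
  by apply/seteqP; split => w /=; [move=> /(_ isT)[? /(_ isT)]|move=> []].
rewrite (_ : [set _ | _] = [set w | n.+1%:R^-1 <= X u w])//.
by apply/seteqP; split => w /=; [move=> /(_ isT)[]|].
Qed.

(** A positive continuous path has a positive minimum on [[0, tau]], and uniform continuity at
    precision [e] times that minimum gives the relative bound. So each path lies in all regular
    events of large index. *)
Lemma probability_regular_event : P (~` regular_event n) @[n --> \oo] --> 0%E.
Proof.
apply: cvg_probability_eventually_empty => [n|w].
  by apply: measurableC; exact: measurable_regular_event.
have cw : {within `[0, tau], continuous (X ^~ w)}.
  by apply: continuous_subspaceW (@cX w) => t /=; rewrite !in_itv/= andbT => /andP[].
have [c] := EVT_min (ltW tau0) cw.
rewrite in_itv/= => /andP[c0 _] minc.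
have Xc : 0 < X c w := X0 _ c0.
have [r r0 Hr] := uniform_continuous_segment tau (@cX w) (mulr_gt0 e0 Xc).
pose n0 := maxn (Num.truncn (X c w)^-1) (Num.truncn (tau / r)).
exists n0 => n nn; apply => N j M i /and4P[N0 jN M0 iM].
have tn (y : R) : (Num.truncn y <= n)%N -> y < n.+1%:R.
  by move=> yn; rewrite (lt_le_trans (truncnS_gt _))// ler_nat.
have gI K k : (0 < K)%N -> (k <= K)%N -> 0 <= g K k <= tau.
  by move=> K0 kK; rewrite grid_time_ge0//= grid_time_le.
have Xmin K k : (0 < K)%N -> (k <= K)%N -> X c w <= X (g K k) w.
  by move=> K0 kK; apply: minc; rewrite in_itv/=; exact: gI.
split.
  rewrite (le_trans _ (Xmin _ _ N0 jN))//.
  rewrite invf_ple ?posrE// ltW// tn// (leq_trans _ nn)// leq_maxl//.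
move=> uv; rewrite (@le_trans _ _ (e * X c w))//; last first.
  by rewrite ler_pM2l// Xmin.
apply/ltW/Hr; [exact: gI|exact: grid_time_ge0|].
rewrite (le_lt_trans uv)// ltr_pdivrMr// mulrC -ltr_pdivrMr// tn//.
by rewrite (leq_trans _ nn)// leq_maxr.
Qed.

(** If the bound failed at a real time [s], with gap [q], it would fail by continuity at a nearby
    fine grid time between the coarse time and [s], where the regular event asserts it. *)
Lemma regular_event_real n w i s : regular_event n w -> (i <= n)%N ->
  g n.+1 i < s <= g n.+1 i.+1 ->
  `|X s w - X (g n.+1 i) w| <= e * X (g n.+1 i) w.
Proof.
move=> Dw iN /andP[gs sg]; set a := g n.+1 i.
have a0 : 0 <= a by exact: grid_time_ge0.
have s0 : 0 < s by rewrite (le_lt_trans a0).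
have st : s <= tau by rewrite (le_trans sg)// grid_time_le.
rewrite leNgt; apply/negP => lt; pose q := `|X s w - X a w| - e * X a w.
have q0 : 0 < q by rewrite subr_gt0.
have [r r0 Hr] := uniform_continuous_segment tau (@cX w) q0.
(* [N] is a multiple of [n.+1], so that [a] is itself a fine grid time and the fine time just before
   [s] cannot precede it; the factor [M] brings the mesh below [r]. *)
pose M := (Num.truncn (tau / r)).+1; pose N := (n.+1 * M)%N.
have N0 : (0 < N)%N by [].
have h0 : 0 < tau / N%:R by rewrite divr_gt0// ltr0n.
have [||j jN /andP[js sj]] := @nat_ceil_exists _ (s / (tau / N%:R)) N.
- by rewrite divr_gt0.
- by rewrite ler_pdivrMr// mulrC divfK// pnatr_eq0 -lt0n.
have {}js : g N j < s by rewrite -ltr_pdivlMr.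
have {}sj : s <= g N j.+1 by rewrite -ler_pdivrMr.
have aE k : g n.+1 k = g N (k * M).
  rewrite /grid_time /N !natrM; field.
  by rewrite nat1r !pnatr_eq0.
have nd : {homo g N : x y / (x <= y)%N >-> x <= y}.
  by move=> x y xy; rewrite ler_wpM2r ?ler_nat// ltW.
have aj : a <= g N j.
  rewrite /a aE nd// -ltnS ltnNge; apply/negP => jiM.
  have := le_lt_trans (le_trans sj (nd _ _ jiM)).
  by rewrite -aE => /(_ _ gs); rewrite ltxx.
have sX : `|X s w - X (g N j) w| < q.
  apply: Hr; [by rewrite ltW|exact: grid_time_ge0|].
  rewrite gtr0_norm ?subr_gt0// ltrBlDr (le_lt_trans sj)//.
  rewrite /grid_time -natr1 mulrDl mul1r addrC ltrD2r.
  rewrite ltr_pdivrMr ?ltr0n// mulrC -ltr_pdivrMr//.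
  by rewrite (lt_le_trans (truncnS_gt _))// ler_nat /N leq_pmull.
have [|_ ] := Dw N j n.+1 i; first by rewrite N0 (ltnW jN)/= leqW.
rewrite ger0_norm ?subr_ge0// => /(_ _)-H.
have {}H : `|X (g N j) w - X a w| <= e * X a w.
  apply: H; rewrite lerBlDr (le_trans (ltW js))// (le_trans sg)//.
  by rewrite /grid_time -natr1 mulrDl mul1r addrC.
have : `|X s w - X a w| < q + e * X a w.
  rewrite (_ : X s w - X a w = (X s w - X (g N j) w) + (X (g N j) w - X a w)).
    by rewrite (le_lt_trans (ler_normD _ _))// ltr_leD.
  by ring.
by rewrite /q subrK ltxx.
Qed.

End regular_paths.

(** * Growth of the geometric Brownian motion *)

Lemma markov_le d (T : measurableType d) (R : realType) (P : probability T R)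
    (Y : T -> R) (a c : R) :
  measurable_fun setT Y -> (forall w, 0 <= Y w) -> 0 < a ->
  (\int[P]_w (Y w)%:E <= c%:E)%E -> (P [set w | (a <= Y w)%R] <= (c / a)%:E)%E.
Proof.
move=> mY Y0 a0 Yc.
have mA : measurable [set w | a <= Y w] by exact: (measurable_le_set (f := cst a)).
rewrite EFinM lee_pdivlMr//; apply: le_trans Yc.
pose A := [set w | a <= Y w].
apply: (@le_trans _ _ (\int[P]_w (a%:E * (\1_A w)%:E))%E).
  rewrite ge0_integralZl//; last 2 first.
  - by apply/measurable_EFinP; exact: measurable_indic.
  - by rewrite lee_fin ltW.
  by rewrite integral_indic// setIT muleC.
apply: ge0_le_integral => //.
- by move=> w _; rewrite -EFinM lee_fin mulr_ge0// ltW.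
- by apply/measurable_EFinP; apply: measurable_funM => //; exact: measurable_indic.
- exact/measurable_EFinP.
- move=> w _; rewrite -EFinM lee_fin indicE.
  by have [/set_mem/=|] := boolP (w \in _); rewrite ?mulr1 ?mulr0.
Qed.

Section gbm_growth.
Context d (T : measurableType d) (R : realType) (P : probability T R).
Variables (F : R -> set (set T)) (W X : R -> T -> R) (mu sigma x : R).
Hypotheses (hF : filtration F) (hW : brownian_motion P F W).
Hypothesis hX : geometric_brownian_motion P mu sigma F W x X.
Hypotheses (sigma0 : 0 < sigma) (mu0 : 0 < mu).
Variables (tau e : R).
Hypotheses (tau0 : 0 < tau) (e0 : 0 < e) (e2 : e <= 1 / 2).
Local Notation g := (grid_time tau).

Let aX : adapted F X. Proof. by case: hX. Qed.
Let cX : continuous_paths X. Proof. by case: hX. Qed.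
Let X0 t w : 0 <= t -> 0 < X t w.
Proof.
move=> t0; have [_ _ + _ _] := hX => /(_ t w t0).
by rewrite /state_space/= in_itv/= andbT.
Qed.
Let mX t : 0 <= t -> measurable_fun setT (X t).
Proof.
move=> t0; have [_ Fm _] := hF.
exact: measurable_wrt_measurable (Fm t t0) (aX t0).
Qed.

Let H (s : R) (w : T) : R := sigma * X s w.

Let aH : adapted F H.
Proof.
move=> t t0; have [sF _ _] := hF.
apply/measurable_wrt_fun; first exact: sF.
by apply: measurable_funM => //; apply/measurable_wrt_fun; [exact: sF|exact: aX].
Qed.

Let cH : continuous_paths H.
Proof. by move=> w t; apply: cvgM; [exact: cvg_cst|exact: (@cX w)]. Qed.

Lemma sp_integral_grid N k w : (k <= N)%N ->
  sp_integral W (grid_process aH tau0 N) (g N k) w =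
  \sum_(0 <= j < k) H (g N j) w * (W (g N j.+1) w - W (g N j) w).
Proof.
move=> kN; rewrite /sp_integral/= -(big_mkord xpredT (fun i => H (g N i) w *
  (W (Num.min (g N i.+1) (g N k)) w - W (Num.min (g N i) (g N k)) w))).
have nd i j : (i <= j)%N -> g N i <= g N j.
  by move=> ij; rewrite ler_wpM2r ?ler_nat// divr_ge0// ltW.
rewrite (big_cat_nat _ kN)//= [X in _ + X]big_nat_cond [X in _ + X]big1 ?addr0.
  rewrite big_nat_cond [RHS]big_nat_cond; apply: eq_bigr => i /andP[/andP[_ ik] _].
  by rewrite !min_l ?nd// ltnW.
move=> i /andP[/andP[ki _] _].
by rewrite !min_r ?subrr ?mulr0// nd// leqW.
Qed.

Lemma grid_time_mul q m k : (0 < m)%N -> g (q * m) (k * m) = g q k.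
Proof.
move=> m0; have [->|q0] := eqVneq q 0%N.
  by rewrite mul0n /grid_time invr0 !mulr0.
by rewrite /grid_time !natrM; field; rewrite !pnatr_eq0 q0 -lt0n m0.
Qed.

(* The integrand sigma * X_s / X_t, t the last of the q coarse grid times before
   the fine grid time s, truncated so as to be bounded. *)
Let coef (q m j : nat) (w : T) : R :=
  sigma * Num.min (X (g (q * m) j) w / X (g q (j %/ m)) w) (1 + e).

(** The martingale part [b_k] of the relative increment of [X] over the coarse step [k]. *)
Let block (q m k : nat) (w : T) : R :=
  \sum_(k * m <= j < k.+1 * m)
    coef q m j w * (W (g (q * m) j.+1) w - W (g (q * m) j) w).

Lemma coef_bound q m j w : `|coef q m j w| <= sigma * (1 + e).
Proof.
rewrite normrM (gtr0_norm sigma0) ler_pM2l// ger0_norm ?ge_min ?lexx ?orbT//.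
rewrite le_min addr_ge0 ?(ltW e0)// andbT divr_ge0// ltW// X0//;
  exact: grid_time_ge0.
Qed.

Lemma coef_measurable q m j : (0 < m)%N ->
  measurable_wrt (F (g (q * m) j)) (coef q m j).
Proof.
move=> m0; have [sF _ Fle] := hF.
have s0 := grid_time_ge0 tau0 (q * m) j; have t0 := grid_time_ge0 tau0 q (j %/ m).
have ts : g q (j %/ m) <= g (q * m) j.
  rewrite -(grid_time_mul q _ m0) ler_wpM2r ?ler_nat ?leq_divM//.
  by rewrite divr_ge0// ltW.
apply/measurable_wrt_fun; first exact: sF.
apply: measurable_funM => //; apply: measurable_minr => //.
apply: measurable_funM.
  by apply/measurable_wrt_fun; [exact: sF|exact: aX].
(* Positivity of [X] lets the inverse be written as a power, whose measurability is available. *)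
rewrite (_ : (fun _ => _) = (@powR R ^~ (-1)) \o X (g q (j %/ m))); last first.
  by apply/funext => w /=; rewrite powR_inv1// ltW// X0.
apply: measurableT_comp; first exact: measurable_powR.
apply/measurable_wrt_fun; first exact: sF.
exact: measurable_wrt_le (Fle _ _ t0 ts) (aX t0).
Qed.

Lemma grid_time_lt N j : (0 < N)%N -> g N j < g N j.+1.
Proof. by move=> N0; rewrite ltr_pM2r ?ltr_nat// divr_gt0// ltr0n. Qed.

Lemma coef_sum_sqr q m a k : (0 < q)%N -> (0 < m)%N ->
  let Y w := \sum_(a <= j < a + k)
    coef q m j w * (W (g (q * m) j.+1) w - W (g (q * m) j) w) in
  measurable_fun setT Y /\
  (\int[P]_w (Y w ^+ 2)%:E <=
   ((sigma * (1 + e)) ^+ 2 * (g (q * m) (a + k) - g (q * m) a))%:E)%E.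
Proof.
move=> q0 m0 Y; have [_ Fm _] := hF.
have qm0 : (0 < q * m)%N by rewrite muln_gt0 q0.
have [mY Y2] := @brownian_sum_sqr _ _ _ P F W (g (q * m)) (coef q m)
  (sigma * (1 + e)) hF hW (grid_time_ge0 tau0 _ _)
  (fun j => grid_time_lt j qm0) (fun j => coef_measurable q j m0)
  (fun j w => coef_bound q m j w) a k.
split=> //; apply: measurable_wrt_measurable mY.
exact/Fm/grid_time_ge0.
Qed.

Lemma block_measurable q m k : (0 < q)%N -> (0 < m)%N ->
  measurable_fun setT (block q m k).
Proof.
move=> q0 m0; have [] := coef_sum_sqr (k * m) m q0 m0.
by rewrite -mulSnr.
Qed.

Lemma block_sqr q m : (0 < q)%N -> (0 < m)%N ->
  (\int[P]_w (\sum_(k < q) block q m k w ^+ 2)%:E <=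
   (sigma ^+ 2 * (1 + e) ^+ 2 * tau)%:E)%E.
Proof.
move=> q0 m0.
under eq_integral do rewrite -sumEFin.
rewrite ge0_integral_sum//; last 2 first.
- move=> k; apply/measurable_EFinP; apply: measurable_funX.
  exact: block_measurable.
- by move=> k w _; rewrite lee_fin sqr_ge0.
apply: (@le_trans _ _ (\sum_(k < q)
    (sigma ^+ 2 * (1 + e) ^+ 2 * (tau / q%:R))%:E)%E).
  apply: lee_sum => k _; have [_] := coef_sum_sqr (k * m) m q0 m0.
  rewrite -mulSnr !grid_time_mul// exprMn.
  by rewrite /grid_time -natr1 mulrDl mul1r addrAC subrr add0r.
rewrite sumEFin lee_fin sumr_const card_ord -[leLHS]mulr_natr.
rewrite [leLHS](_ : _ = sigma ^+ 2 * (1 + e) ^+ 2 * tau)//.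
by field; rewrite pnatr_eq0 -lt0n.
Qed.

Lemma sum_block q m w : \sum_(k < q) block q m k w =
  \sum_(0 <= j < 0 + q * m)
    coef q m j w * (W (g (q * m) j.+1) w - W (g (q * m) j) w).
Proof. by rewrite add0n big_nat_mul big_mkord. Qed.

Lemma sum_block_sqr q m : (0 < q)%N -> (0 < m)%N ->
  (\int[P]_w ((\sum_(k < q) block q m k w) ^+ 2)%:E <=
   (sigma ^+ 2 * (1 + e) ^+ 2 * tau)%:E)%E.
Proof.
move=> q0 m0; have [_] := coef_sum_sqr 0 (q * m) q0 m0.
under [X in _ -> (X <= _)%E]eq_integral do rewrite sum_block.
rewrite -exprMn; congr (_ <= (_ * _)%:E)%E.
rewrite add0n /grid_time mul0r subr0 mulrC divfK//.
by rewrite pnatr_eq0 -lt0n muln_gt0 q0.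
Qed.

(** On a regular path the truncation in [coef] is inactive; multiplying by [X] at the left end of
    the coarse step restores the integrand [sigma * X]. *)
Lemma block_regular n m k w : (0 < m)%N -> (k <= n)%N -> regular_event X tau e n w ->
  let N := (n.+1 * m)%N in
  block n.+1 m k w * X (g n.+1 k) w =
  sp_integral W (grid_process aH tau0 N) (g n.+1 k.+1) w
  - sp_integral W (grid_process aH tau0 N) (g n.+1 k) w.
Proof.
move=> m0 kn Dw N.
have Xk : X (g n.+1 k) w != 0 by rewrite gt_eqF// X0// grid_time_ge0.
rewrite -!(grid_time_mul n.+1 _ m0) !sp_integral_grid ?leq_mul2r ?ltnS ?kn ?(leqW kn) ?orbT//.
rewrite [X in X - _](big_cat_nat (n := k * m))//= ?leq_mul2r ?leqnSn ?orbT//.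
rewrite addrAC subrr add0r mulr_suml [LHS]big_nat_cond [RHS]big_nat_cond.
apply: eq_bigr => j /andP[/andP[kj jk] _].
have jm : (j %/ m = k)%N.
  apply/eqP; rewrite eqn_leq -ltnS ltn_divLR// jk/=.
  by rewrite leq_divRL.
rewrite mulrAC; congr (_ * _); rewrite /coef /H jm -/N -mulrA; congr (_ * _).
rewrite min_l; first by rewrite /N grid_time_mul// divfK.
rewrite ler_pdivrMr ?X0 ?grid_time_ge0//.
have [|_] := Dw N j n.+1 k.
  by rewrite muln_gt0 m0/= (ltnW (leq_trans jk _)) ?leq_mul2r ?ltnS ?kn ?orbT// leqW.
rewrite -(grid_time_mul n.+1 k m0) -/N.
have jt : `|g N j - g N (k * m)| <= tau / n.+1%:R.
  rewrite ger0_norm ?subr_ge0; last first.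
    by rewrite ler_wpM2r ?ler_nat// divr_ge0// ltW.
  rewrite lerBlDr (@le_trans _ _ (g N (k.+1 * m)))//.
    by rewrite ler_wpM2r ?ler_nat 1?ltnW// divr_ge0// ltW.
  by rewrite !grid_time_mul// /grid_time -natr1 mulrDl mul1r addrC.
by move=> /(_ jt); rewrite ler_norml => /andP[_]; lra.
Qed.

(** The pathwise part of the argument, on a path avoiding all exceptional events. The power
    [(1 + e) ^+ 4] is the bound on the sum of squares times the Young factor [1 + e]; the final
    [- 1] pays for the squared drifts, whose total is at most 1 for large [n]. *)
Lemma gbm_good_path (M : R -> T -> R) (th : R) n m w :
  (0 < m)%N -> regular_event X tau e n w -> X 0 w = x ->
  (forall k, (k <= n.+1)%N -> X (g n.+1 k) w = x +
     \int[lebesgue_measure]_(s in `[0, g n.+1 k]) (mu * X s w) + M (g n.+1 k) w) ->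
  (forall k, (k <= n.+1)%N ->
     `|sp_integral W (grid_process aH tau0 (n.+1 * m)) (g n.+1 k) w
       - M (g n.+1 k) w| < th) ->
  2 * th * n.+1%:R <= mu * e * (tau / n.+1%:R) ->
  (1 / 2 + e) * ((1 + e^-1) * (2 * mu * tau) ^+ 2) <= n.+1%:R ->
  - e * tau < \sum_(k < n.+1) block n.+1 m k w ->
  \sum_(k < n.+1) block n.+1 m k w ^+ 2 < sigma ^+ 2 * (1 + e) ^+ 3 * tau ->
  x * expR (tau * (mu * (1 - 2 * e) - e
                   - (1 / 2 + e) * (1 + e) ^+ 4 * sigma ^+ 2) - 1) <= X tau w.
Proof.
move=> m0 Dw Xx sde IM thb nb b1 b2.
pose h := tau / n.+1%:R; have h0 : 0 < h by rewrite divr_gt0.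
pose Xk k := X (g n.+1 k) w.
have Xk0 k : 0 < Xk k by apply/X0/grid_time_ge0.
have Xkn k : (k <= n.+1)%N -> n.+1%:R^-1 <= Xk k.
  by move=> kn; have [|//] := Dw n.+1 k n.+1 k; rewrite kn.
have gh k : g n.+1 k.+1 - g n.+1 k = h.
  by rewrite /grid_time -natr1 mulrDl mul1r addrAC subrr add0r.
have glt k : g n.+1 k < g n.+1 k.+1 by rewrite -subr_gt0 gh.
pose r k := Xk k.+1 / Xk k - 1.
pose b k := block n.+1 m k w.
have rX k : r k * Xk k = Xk k.+1 - Xk k.
  by rewrite mulrBl divfK ?mul1r// gt_eqF.
have re k : (k < n.+1)%N -> `|r k| <= e.
  move=> kn; rewrite -(ler_pM2r (Xk0 k)) -[X in _ * X <= _](gtr0_norm (Xk0 k)).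
  rewrite -normrM rX; apply: regular_event_real => //.
  by rewrite glt lexx.
(* One [mu * e * h] comes from freezing [X] in the drift integral, the other from the two errors
   [th] of the stochastic integral: as [Xk k >= n.+1%:R^-1], these stay small relative to [Xk k]. *)
have dE k : (k < n.+1)%N -> `|(r k - b k) - mu * h| <= 2 * mu * e * h.
  move=> kn; rewrite -(ler_pM2r (Xk0 k)) -[X in _ * X <= _](gtr0_norm (Xk0 k)).
  rewrite -normrM.
  have bX := block_regular m0 (kn : (k <= n)%N) Dw.
  have [i0 i1] := (IM k (ltnW kn), IM k.+1 kn).
  have cmu : {within `[0, g n.+1 k.+1], continuous (fun s => mu * X s w)}.
    apply: (continuous_subspaceW _
      (_ : {within `[0, +oo[, continuous (fun s => mu * X s w)})).
      by move=> t /=; rewrite !in_itv/= andbT => /andP[].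
    by move=> t; apply: cvgM; [exact: cvg_cst|exact: (@cX w)].
  have := @Rintegral_increment _ (fun s => mu * X s w) (g n.+1 k) (g n.+1 k.+1)
    (mu * Xk k) (mu * e * Xk k) (grid_time_ge0 tau0 _ _) (ltW (glt k)) cmu.
  rewrite gh => incr.
  have {}incr := incr _.
  have {incr} : `|\int[lebesgue_measure]_(s in `[0, g n.+1 k.+1]) (mu * X s w) -
       \int[lebesgue_measure]_(s in `[0, g n.+1 k]) (mu * X s w) -
       mu * Xk k * h| <= mu * e * Xk k * h.
    apply: incr => s sI; rewrite -mulrBr normrM gtr0_norm// -mulrA ler_pM2l//.
    exact: regular_event_real sI.
  set J1 := (X in `|X - _ - mu * Xk k * h|).
  set J0 := (X in `|_ - X - mu * Xk k * h|) => J.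
  have E1 := sde k.+1 kn; have E0 := sde k (ltnW kn).
  rewrite -/(Xk k.+1) -/J1 in E1; rewrite -/(Xk k) -/J0 in E0.
  rewrite mulrBl mulrBl rX {1}/b bX.
  move: i0 i1; set I0 := sp_integral _ _ _ _; set I1 := sp_integral _ _ _ _.
  move: E1 E0 J; set M1 := M _ _; set M0 := M _ _.
  have X1 := Xkn k (ltnW kn).
  have XX : 2 * th <= mu * e * h * Xk k.
    rewrite -ler_pdivlMr// in thb.
    apply: le_trans thb _; rewrite ler_pM2l//.
    by rewrite !mulr_gt0.
  move: (Xk k) (Xk k.+1) XX => u v XX E1 E0.
  rewrite !ler_norml !ltr_norml => /andP[J2 J3] /andP[i1 i2] /andP[i3 i4].
  by apply/andP; split; lra.
have sumln : \sum_(k < n.+1) ln (1 + r k) = ln (X tau w) - ln x.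
  rewrite -(big_mkord xpredT (fun k => ln (1 + r k))).
  rewrite (@telescope_sumr_eq _ 0 n.+1 (fun k => ln (Xk k)))//.
    rewrite /Xk /grid_time mul0r Xx; congr (ln (X _ w) - _).
    by rewrite mulrC divfK.
  move=> k _; rewrite /r [X in ln X](_ : _ = Xk k.+1 / Xk k); last by ring.
  by rewrite ln_div ?posrE.
have nh : n.+1%:R * h = tau by rewrite mulrC divfK.
have rE k : (k < n.+1)%N -> r k = (r k - b k) + b k by rewrite subrK.
have := sum_ln1D_ge e0 e2 (ltW mu0) (ltW h0) nh re rE dE (ltW b1) (ltW b2).
rewrite sumln.
have x0 : 0 < x by rewrite -Xx; exact: X0.
have Xt0 : 0 < X tau w by rewrite X0// ltW.
rewrite -[X in X * expR _](lnK x0) -expRD -[X in _ -> _ <= X](lnK Xt0) ler_expR.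
have -> : (1 + e^-1) * (2 * mu * h) ^+ 2 * n.+1%:R =
    (1 + e^-1) * (2 * mu * tau) ^+ 2 / n.+1%:R.
  by rewrite /h; field; rewrite nat1r pnatr_eq0 (gt_eqF e0).
have : (1 / 2 + e) * ((1 + e^-1) * (2 * mu * tau) ^+ 2 / n.+1%:R) <= 1.
  by rewrite mulrA ler_pdivrMr ?ltr0n// [leRHS]mul1r.
set z := (_ / n.+1%:R); set lx := ln x; set lX := ln (X tau w).
nra.
Qed.

Lemma cvg0_near_le (u : nat -> \bar R) (r : R) : 0 < r ->
  u n @[n --> \oo] --> 0%E -> \forall n \near \oo, (u n <= r%:E)%E.
Proof.
move=> r0 u0; have r0' : (0 < r%:E)%E by rewrite lte_fin.
have H0 : nbhs (0%E : \bar R) [set y | (y < r%:E)%E] := open_ereal_lt' r0'.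
have H1 : \forall n \near \oo, (u n < r%:E)%E := u0 _ H0.
by near=> n; apply/ltW; near: n.
Unshelve. all: by end_near.
Qed.

(** A union bound over exceptional events: Markov for the sum of squares costs [(1 + e)^-1],
    Chebyshev for the sum costs the next term, and [eta] is shared equally between irregular paths
    and errors of the Ito approximation. *)
Lemma gbm_growth_probability (eta : R) : 0 < eta ->
  ((1 - (1 + e)^-1 - sigma ^+ 2 * (1 + e) ^+ 2 / (e ^+ 2 * tau) - eta)%:E <=
   P [set w | (x * expR (tau * (mu * (1 - 2 * e) - e
      - (1 / 2 + e) * (1 + e) ^+ 4 * sigma ^+ 2) - 1) <= X tau w)%R])%E.
Proof.
move=> eta0; have [_ _ _ Xx [M itoM sde]] := hX.
set S := [set w | _].
have mS : measurable S.
  by apply: (measurable_le_set (f := cst _)) => //; apply/mX/ltW.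
have eta2 : 0 < eta / 2 by rewrite divr_gt0.
(* The order of choices matters: first the coarse grid [n], then the tolerance [th] depending on it,
   finally the refinement [m] depending on both. *)
have [n [PD nb]] : exists n,
    (P (~` regular_event X tau e n) <= (eta / 2)%:E)%E /\
    (1 / 2 + e) * ((1 + e^-1) * (2 * mu * tau) ^+ 2) <= n.+1%:R.
  have H1 := cvg0_near_le eta2 (@probability_regular_event _ _ _ P X tau e mX cX X0 tau0 e0).
  have H2 : \forall n \near \oo,
      (1 / 2 + e) * ((1 + e^-1) * (2 * mu * tau) ^+ 2) <= n.+1%:R.
    exists (Num.truncn ((1 / 2 + e) * ((1 + e^-1) * (2 * mu * tau) ^+ 2))) => // n /= nn.
    by rewrite ltW// (lt_le_trans (truncnS_gt _))// ler_nat.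
  by have [n _ Hn] := filterI H1 H2; exists n; exact: Hn (leqnn n).
pose q := n.+1; pose th := mu * e * (tau / q%:R) / (2 * q%:R).
have q0 : 0 < q%:R :> R by rewrite ltr0n.
have th0 : 0 < th.
  apply: divr_gt0; last exact: mulr_gt0.
  by apply: mulr_gt0; [exact: mulr_gt0|exact: divr_gt0].
have thb : 2 * th * q%:R <= mu * e * (tau / q%:R).
  by rewrite le_eqVlt; apply/orP; left; apply/eqP; rewrite /th; field; rewrite gt_eqF.
pose I m k w := sp_integral W (grid_process aH tau0 (q * m.+1)) (g q k) w.
pose E m k := [set w | th <= `|I m k w - M (g q k) w|].
(* Convergence in probability to the Ito integral, used at all [q.+1] coarse times
   simultaneously. *)
have [m PE] : exists m, forall k : 'I_q.+1, (P (E m k) <= (eta / 2 / q.+1%:R)%:E)%E.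
  have H1 : \forall m \near \oo, forall k : 'I_q.+1,
      (P (E m k) <= (eta / 2 / q.+1%:R)%:E)%E.
    apply: filter_forall => k; apply: cvg0_near_le; first by rewrite divr_gt0// ltr0n.
    have [_ _ itoc] := itoM _ (grid_time_ge0 tau0 q k).
    apply: (itoc (fun m => grid_process aH tau0 (q * m.+1))) => //.
    apply: grid_process_approximates => //; first exact: grid_time_ge0.
      by apply: grid_time_le => //; rewrite -ltnS.
    by move=> j; exact: leq_pmull.
  by have [m _ Hm] := H1; exists m; exact: Hm (leqnn m).
pose bl k w := block q m.+1 k w.
have mbl k : measurable_fun setT (bl k) by exact: block_measurable.
have msb : measurable_fun setT (fun w => \sum_(k < q) bl k w) by exact: measurable_sum.
have msb2 : measurable_fun setT (fun w => \sum_(k < q) bl k w ^+ 2).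
  by apply: measurable_sum => k; exact: measurable_funX.
pose A := [set w | (e * tau) ^+ 2 <= (\sum_(k < q) bl k w) ^+ 2].
have et0 : 0 < e * tau by rewrite mulr_gt0.
have PA : (P A <= (sigma ^+ 2 * (1 + e) ^+ 2 / (e ^+ 2 * tau))%:E)%E.
  rewrite (_ : _ / (e ^+ 2 * tau) =
      (sigma ^+ 2 * (1 + e) ^+ 2 * tau) / (e * tau) ^+ 2); last first.
    by field; rewrite !gt_eqF.
  apply: markov_le; first exact: measurable_funX.
  - by move=> w; exact: sqr_ge0.
  - by rewrite exprn_gt0.
  - exact: sum_block_sqr.
pose Q := sigma ^+ 2 * (1 + e) ^+ 3 * tau.
have e1 : 0 < 1 + e by rewrite addr_gt0.
have Q0 : 0 < Q by rewrite !mulr_gt0// exprn_gt0.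
pose B := [set w | Q <= \sum_(k < q) bl k w ^+ 2].
have PB : (P B <= ((1 + e)^-1)%:E)%E.
  rewrite (_ : (1 + e)^-1 = (sigma ^+ 2 * (1 + e) ^+ 2 * tau) / Q); last first.
    by rewrite /Q; field; rewrite !gt_eqF.
  apply: markov_le => //; last exact: block_sqr.
  by move=> w; apply: sumr_ge0 => k _; exact: sqr_ge0.
(* The equation holds almost surely at each fixed time; the countably many grid times share one null
   set. *)
have [Z [mZ PZ HZ]] : P.-negligible (~` [set w | X 0 w = x /\
    forall k, X (g q k) w = x +
      \int[lebesgue_measure]_(s in `[0, g q k]) (mu * X s w) + M (g q k) w]).
  apply: filterI Xx _; apply: ae_foralln => k; exact/sde/grid_time_ge0.
have mE k : measurable (E m k).
  have [aW _ _ _ _] := hW; have [_ Fm _] := hF.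
  have mW t : 0 <= t -> measurable_fun setT (W t).
    by move=> t0; exact: measurable_wrt_measurable (Fm t t0) (aW t t0).
  have gk := grid_time_ge0 tau0 q k.
  apply: (measurable_le_set (f := cst _)) => //.
  apply: measurableT_comp => //; apply: measurable_funB; last first.
    by have [] := itoM _ gk.
  apply: measurable_sum => j; apply: measurable_funM.
    exact: measurable_wrt_measurable (Fm _ (grid_time_ge0 tau0 _ _))
      (aH (grid_time_ge0 tau0 _ _)).
  by apply: measurable_funB; apply: mW; rewrite le_min gk andbT grid_time_ge0.
have mA : measurable A.
  by apply: (measurable_le_set (f := cst _)) => //; exact: measurable_funX.
have mB : measurable B by exact: (measurable_le_set (f := cst _)).
have mD : measurable (~` regular_event X tau e n).
  by apply: measurableC; exact: measurable_regular_event.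
pose U := \big[setU/set0]_(k < q.+1) E m k.
have mU : measurable U by exact: bigsetU_measurable.
have PU : (P U <= (eta / 2)%:E)%E.
  apply: (le_trans (Boole_inequality P (A := E m) _)) => [k _|]; first exact: mE.
  apply: (@le_trans _ _ (\sum_(k < q.+1) (eta / 2 / q.+1%:R)%:E)%E).
    by apply: lee_sum => k _; exact: PE.
  rewrite sumEFin lee_fin sumr_const card_ord -[leLHS]mulr_natr divfK//.
have cover : setT `<=` S `|` (Z `|` (~` regular_event X tau e n `|` (U `|` (A `|` B)))).
  move=> w _; apply: contrapT => /not_orP[nS] /not_orP[nZ] /not_orP[/contrapT Dw].
  move=> /not_orP[nU] /not_orP[nA nB].
  have [Xw sdew] : X 0 w = x /\ forall k, X (g q k) w = x +
      \int[lebesgue_measure]_(s in `[0, g q k]) (mu * X s w) + M (g q k) w.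
    by apply: contrapT => nw; apply/nZ/HZ.
  apply: nS; apply: (@gbm_good_path M th n m.+1 w) => //.
  - move=> k kn; rewrite ltNge; apply/negP => Ek; apply: nU.
    by rewrite /U -bigcup_mkord; exists k.
  - move/negP: nA; rewrite -ltNge -[ltLHS]real_normK ?num_real//.
    rewrite ltr_pXn2r ?nnegrE// ?ltW// ltr_norml => /andP[+ _].
    by rewrite mulNr.
  - by move/negP: nB; rewrite -ltNge.
have P1 : (1 <= P S + (0 + ((eta / 2)%:E + ((eta / 2)%:E +
    ((sigma ^+ 2 * (1 + e) ^+ 2 / (e ^+ 2 * tau))%:E + ((1 + e)^-1)%:E)))))%E.
  rewrite -(probability_setT P).
  have mAB : measurable (A `|` B) by exact: measurableU.
  have mUAB := measurableU _ _ mU mAB.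
  have mDU := measurableU _ _ mD mUAB.
  have mZU := measurableU _ _ mZ mDU.
  apply: (le_trans (le_measure P _ _ cover)); rewrite ?inE//.
    exact: measurableU.
  apply: (le_trans (measureU2 P mS mZU)); apply: leeD => //.
  apply: (le_trans (measureU2 P mZ mDU)); apply: leeD.
    by rewrite le_eqVlt; apply/orP; left; apply/eqP; exact: PZ.
  apply: (le_trans (measureU2 P mD mUAB)); apply: leeD => //.
  apply: (le_trans (measureU2 P mU mAB)); apply: leeD => //.
  by apply: (le_trans (measureU2 P mA mB)); exact: leeD.
move: P1; rewrite add0e -!EFinD -leeBlDr// -EFinB; apply: le_trans.
by rewrite lee_fin; lra.
Qed.

End gbm_growth.

(** Growth at the exponential rate [K / 2] beats any linear function of time. The bound [c] depends
    on [e] alone, and [e] is fixed before [k] and [t]. *)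
Lemma gbm_linear_growth d (T : measurableType d) (R : realType) (P : probability T R)
    (F : R -> set (set T)) (W X : R -> T -> R) (mu sigma x beta : R) :
  filtration F -> brownian_motion P F W ->
  geometric_brownian_motion P mu sigma F W x X ->
  0 < sigma -> 0 < x -> 0 < beta -> 0 < mu - sigma ^+ 2 / 2 ->
  exists2 c : R, 0 < c & forall k : nat, exists t : R,
    [/\ 0 < t, k%:R <= t & (c%:E <= P [set w | (k%:R * (1 + beta * t) <= X t w)%R])%E].
Proof.
move=> hF hW hX sigma0 x0 beta0; set K := mu - _ => K0.
have s2 : 0 < sigma ^+ 2 by rewrite exprn_gt0.
have mu0 : 0 < mu by move: K0; rewrite /K; lra.
(* The loss in the growth rate is at most [e * (2 * mu + 1 + 24 * sigma ^+ 2)], which equals [K / 2]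
   for [e = K / D]. *)
pose D := 2 * (2 * mu + 1 + 24 * sigma ^+ 2).
have D0 : 0 < D by rewrite /D; lra.
pose e := K / D.
have e0 : 0 < e by rewrite divr_gt0.
have eD : e * D = K by rewrite divfK// gt_eqF.
have e2 : e <= 1 / 2 by rewrite ler_pdivrMr// /K /D; lra.
have rate : K / 2 <= mu * (1 - 2 * e) - e - (1 / 2 + e) * (1 + e) ^+ 4 * sigma ^+ 2.
  have h1 : (1 + e) ^+ 2 <= 1 + 3 * e by nra.
  have h2 : (1 + e) ^+ 4 <= 1 + 15 * e.
    rewrite (_ : 4%N = (2 * 2)%N)// exprM (@le_trans _ _ ((1 + 3 * e) ^+ 2))//.
      by rewrite lerXn2r ?nnegrE ?sqr_ge0//; lra.
    by nra.
  have h3 : (1 / 2 + e) * (1 + e) ^+ 4 <= 1 / 2 + 24 * e.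
    rewrite (@le_trans _ _ ((1 / 2 + e) * (1 + 15 * e)))//.
      by rewrite ler_wpM2l//; lra.
    by nra.
  have : (1 / 2 + e) * (1 + e) ^+ 4 * sigma ^+ 2 <= (1 / 2 + 24 * e) * sigma ^+ 2.
    by rewrite ler_pM2r.
  by move: eD; rewrite /D /K; lra.
(* Of the available [2 * c], the Chebyshev term and [eta] each use at most [c / 2]. *)
pose c := (1 - (1 + e)^-1) / 2.
have c0 : 0 < c by rewrite divr_gt0// subr_gt0 invf_lt1 ?ltrDl// addr_gt0.
exists c => // k.
pose v := sigma ^+ 2 * (1 + e) ^+ 2 / e ^+ 2.
have v0 : 0 <= v by apply: divr_ge0; [apply: mulr_ge0|]; exact: sqr_ge0.
(* [t >= a1] makes the Chebyshev term [v / t] at most [c / 2]. *)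
pose a1 := 2 * v / c.
have a10 : 0 <= a1 by apply: divr_ge0; [exact: mulr_ge0|exact: ltW].
have xe0 : 0 < x * expR (-1) by rewrite mulr_gt0// expR_gt0.
(* With [z = t * (K / 2)] and [expR z >= z ^+ 2 / 2], the condition [t >= a2] gives [x * expR (z -
   1) >= k%:R * (1 + beta) * t], and [t >= 1] bounds [1 + beta * t] by [(1 + beta) * t]. *)
pose a2 := 8 * k%:R * (1 + beta) / (K ^+ 2 * (x * expR (-1))).
have K2 : 0 < K ^+ 2 * (x * expR (-1)) by rewrite mulr_gt0// exprn_gt0.
have b1 : 0 <= 1 + beta by rewrite addr_ge0// ltW.
have a20 : 0 <= a2.
  by apply: divr_ge0 (ltW K2); apply: mulr_ge0 b1; exact: mulr_ge0.
pose t := 1 + k%:R + a1 + a2.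
have k0 : 0 <= k%:R :> R by [].
have t0 : 0 < t by rewrite /t; lra.
exists t; split => //; first by rewrite /t; lra.
have := @gbm_growth_probability _ _ _ P F W X mu sigma x hF hW hX sigma0 mu0 t e t0 e0 e2
  (c / 2) (divr_gt0 c0 (ltr0Sn _ 1)).
have [_ Fm _] := hF; have [aX _ _ _ _] := hX.
have mX : measurable_fun setT (X t).
  exact: measurable_wrt_measurable (Fm t (ltW t0)) (aX t (ltW t0)).
set y := (_ - 1) => H; apply: (le_trans _ (le_trans H _)).
  rewrite lee_fin.
  have -> : sigma ^+ 2 * (1 + e) ^+ 2 / (e ^+ 2 * t) = v / t.
    by rewrite /v; field; rewrite !gt_eqF.
  have : v / t <= c / 2.
    have : a1 <= t by rewrite /t; lra.
    by rewrite ler_pdivrMr// [leRHS]mulrC ler_pdivrMr//; lra.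
  have : 1 - (1 + e)^-1 = 2 * c by rewrite /c; field; rewrite gt_eqF// addr_gt0.
  lra.
apply: le_measure; rewrite ?inE//.
- exact: (measurable_le_set (f := cst _)).
- exact: (measurable_le_set (f := cst _)).
move=> w /=; apply: le_trans.
have y1 : t * (K / 2) - 1 <= y by rewrite /y lerD2r ler_pM2l.
apply: (@le_trans _ _ (x * expR (t * (K / 2) - 1))); last first.
  by rewrite ler_pM2l// ler_expR.
have z0 : 0 <= t * (K / 2) by rewrite mulr_ge0 ?divr_ge0// ltW.
have := expR_ge1Dxn 1 z0; rewrite expRD.
set E := expR (t * (K / 2)) => HE.
apply: (@le_trans _ _ (k%:R * ((1 + beta) * t))).
  by rewrite ler_wpM2l// mulrDl mul1r lerD2r /t; lra.
apply: (@le_trans _ _ (x * expR (-1) * ((t * (K / 2)) ^+ 2 / 2))); last first.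
  rewrite (_ : x * (E * _) = x * expR (-1) * E); last by ring.
  by rewrite ler_pM2l// (le_trans _ HE)// ler_wpDl.
have : a2 <= t by rewrite /t; lra.
rewrite /a2 ler_pdivrMr// => a2t.
have : t * (8 * k%:R * (1 + beta)) <= t * (t * (K ^+ 2 * (x * expR (-1)))).
  by rewrite ler_pM2l.
set X1 := x * expR (-1); lra.
Qed.

(** * The value of the empty region *)

Section integral_lower_bound.
Import HBNNSimple.

(** Obtained from the definition of the integral as a supremum over simple functions, so that it
    applies to the payoff, a limsup over uncountably many times whose measurability is not at
    hand. *)
Lemma ge0_integral_ge_cst d (T : measurableType d) (R : realType)
    (m : {measure set T -> \bar R}) (f : T -> \bar R) (L : set T) (r : R) :
  (forall w, 0 <= f w)%E -> measurable L -> 0 <= r ->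
  (forall w, L w -> (r%:E <= f w)%E) -> (r%:E * m L <= \int[m]_w f w)%E.
Proof.
move=> f0 mL r0 fL; rewrite ge0_integralTE//.
pose h := scale_nnsfun (indic_nnsfun R mL) r0.
have -> : (r%:E * m L = sintegral m h)%E.
  rewrite -integralT_nnsfun.
  under eq_integral do rewrite /= EFinM.
  rewrite ge0_integralZl//; last 2 first.
  - by apply/measurable_EFinP; exact: measurable_indic.
  - by move=> w _; rewrite lee_fin mindicE.
  by rewrite integral_indic// setIT.
apply: ereal_sup_ubound; exists h => // w /=; rewrite mindicE.
by have [/set_mem/fL|_] := boolP (w \in L); rewrite ?mulr1 ?mulr0.
Qed.

End integral_lower_bound.

(** Every neighbourhood of infinity contains some []M, +oo[]; taking [n] above both [M] and the
    target [A] makes the supremum there at least [A]. *)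
Lemma limf_esup_pinfty (R : realType) (f : R -> \bar R) :
  (forall n : nat, exists t : R, n%:R <= t /\ (n%:R%:E <= f t)%E) ->
  limf_esup f (pinfty_nbhs R) = +oo%E.
Proof.
move=> Hf; apply/eqP; rewrite -leye_eq; apply: le_ereal_inf_tmp => _ [V [M [_ MV]] <-].
rewrite leye_eq; apply/eqP/eqyP => A A0.
pose n := maxn (Num.truncn M).+1 (Num.truncn A).+1.
have [t [nt nf]] := Hf n.
apply: (@le_trans _ _ (f t)).
  apply: le_trans nf; rewrite lee_fin ltW// (lt_le_trans (truncnS_gt _))//.
  by rewrite ler_nat leq_maxr.
apply: ereal_sup_ubound; exists t => //; apply: MV.
by rewrite (lt_le_trans (truncnS_gt _))// (le_trans _ nt)// ler_nat leq_maxl.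
Qed.

Section empty_region.
Context d (T : measurableType d) (R : realType) (P : probability T R).
Variables (X : R -> R -> T -> R) (beta x : R).
Local Notation f := (fun x : R => x).
Local Notation delta := (fun t : R => 1 / (1 + beta * t)).

Lemma hitting_time_set0 w : hitting_time X x set0 w = +oo%E.
Proof.
rewrite /hitting_time (_ : [set _ | _ in _] = set0) ?ereal_inf0//.
by apply/seteqP; split=> // y [t [_ []]].
Qed.

(** Events of probability at least [c] occur infinitely often with probability at least [c], and on
    that set the discounted payoff has limsup [+oo]. *)
Lemma J_set0_pinfty : 0 < beta ->
  (forall t, 0 <= t -> measurable_fun setT (X x t)) ->
  (forall t w, 0 <= t -> 0 < X x t w) ->
  (exists2 c : R, 0 < c & forall k : nat, exists t : R, [/\ 0 < t, k%:R <= t &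
     (c%:E <= P [set w | (k%:R * (1 + beta * t) <= X x t w)%R])%E]) ->
  J P X f delta x set0 = +oo%E.
Proof.
move=> beta0 mX X0 [c c0 /choice[t /all_and3[t0 kt Pc]]].
have b0 k : 0 < 1 + beta * t k by rewrite addr_gt0// mulr_gt0.
pose E k := [set w | k%:R * (1 + beta * t k) <= X x (t k) w].
have mE k : measurable (E k).
  by apply: (measurable_le_set (f := cst _)) => //; apply/mX/ltW.
have mL : measurable (lim_sup_set E).
  by apply: bigcap_measurable => // n _; exact: bigcup_measurable.
have PL : (c%:E <= P (lim_sup_set E))%E.
  have mU n : measurable (\bigcup_(k >= n) E k) by exact: bigcup_measurable.
  have Ufin : (P (\bigcup_(k >= 0) E k) < +oo)%E.
    by rewrite (le_lt_trans (probability_le1 _ (mU 0%N)))// ltry.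
  have cvgU := @lim_sup_set_cvg _ T R P E mE Ufin.
  apply: cvge_ge cvgU.
  near=> n; apply: (le_trans (Pc n)); apply: le_measure; rewrite ?inE.
  - exact: mE.
  - exact: mU.
  - by move=> w Ew; exists n => /=.
have Linf w : lim_sup_set E w -> stopped_payoff X f delta x set0 w = +oo%E.
  move=> Lw; rewrite /stopped_payoff hitting_time_set0; apply: limf_esup_pinfty => n.
  have [k /= nk Ek] := Lw n Logic.I.
  exists (t k); split; first by rewrite (le_trans _ (kt k))// ler_nat.
  rewrite lee_fin mul1r mulrC ler_pdivlMr//; apply: le_trans Ek.
  by rewrite ler_wpM2r ?ler_nat// ltW.
have pay0 w : (0 <= stopped_payoff X f delta x set0 w)%E.
  rewrite /stopped_payoff hitting_time_set0 limf_esupE.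
  apply: le_ereal_inf_tmp => _ [V [M [_ MV]] <-].
  pose s := Num.max 0 (M + 1).
  have s0 : 0 <= s by rewrite le_max lexx.
  apply: (@le_trans _ _ (delta s * X x s w)%:E).
    by rewrite lee_fin mulr_ge0 ?(ltW (X0 _ _ _))// divr_ge0// addr_ge0// mulr_ge0// ltW.
  apply: ereal_sup_ubound; exists s => //; apply: MV.
  by rewrite lt_max ltrDl ltr01 orbT.
apply/eqyP => A A0.
(* The payoff exceeds the constant [A / c] on a set of probability at least [c], so its integral is
   at least [A], for arbitrary [A]. *)
have Ac : 0 <= A / c by rewrite divr_ge0// ltW.
apply: (le_trans _ (ge0_integral_ge_cst P pay0 mL Ac _)); last first.
  by move=> w /Linf ->; rewrite leey.
apply: (@le_trans _ _ ((A / c)%:E * c%:E)%E).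
  by rewrite -EFinM divfK// gt_eqF.
by apply: lee_wpmul2l => //; rewrite lee_fin.
Unshelve. all: by end_near. Qed.

End empty_region.

(** * Optimality of the empty equilibrium *)

Theorem proposition6p2 (R : realType) (d : measure_display) (T : measurableType d)
    (P : probability T R) (F : R -> set (set T)) (W : R -> T -> R)
    (X : R -> R -> T -> R) (mu sigma beta nu : R)
    (hF : filtration F) (hW : brownian_motion P F W)
    (hsigma : 0 < sigma) (hbeta : 0 < beta)
    (hX : forall x : R, state_space x ->
       geometric_brownian_motion P mu sigma F W x (X x))
    (nuE : nu = mu / sigma ^+ 2 - 1 / 2) (hnu : 0 < nu) :
  let f := fun x : R => x in
  let delta := fun t : R => 1 / (1 + beta * t) in
  Rstar P X f delta = set0 /\
  optimal_equilibrium P X f delta (Rstar P X f delta).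
Proof.
move=> f delta.
have J0 x : state_space x -> J P X f delta x set0 = +oo%E.
  move=> xS; have gX := hX x xS; have [_ Fm _] := hF.
  have [aX _ pX _ _] := gX.
  have x0 : 0 < x by move: xS; rewrite /state_space/= in_itv/= andbT.
  apply: J_set0_pinfty => //.
  - by move=> t t0; exact: measurable_wrt_measurable (Fm t t0) (aX t t0).
  - by move=> t w t0; have := pX t w t0; rewrite /state_space/= in_itv/= andbT.
  (* The required [mu - sigma ^+ 2 / 2] is [sigma ^+ 2 * nu]. *)
  - apply: (gbm_linear_growth hF hW gX) => //.
    move: hnu; rewrite nuE subr_gt0 ltr_pdivlMr ?exprn_gt0//; lra.
have eq0 : equilibrium P X f delta set0.
  split=> //; apply/seteqP; split=> // x [[xS]|[_ []]//].
  by rewrite J0// ltNge leey.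
have R0 : Rstar P X f delta = set0.
  apply/seteqP; split=> // x [_] /(_ set0); apply; split=> //.
  by exists set0; [exact: closed0|rewrite set0I].
split=> //; rewrite R0; split=> // x xS B _.
by rewrite /V J0// [leRHS]max_r ?leey.
Qed.
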